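(* Let $n\ge 2$ and $d\ge 1$ be integers and let $L=K(n,\{1,\ldots,nd+1\})$ be the Kneser complex. Then the group $G=\mathrm{Aut}\,D(L)$ is virtually simple, where $D(L)$ is the Davis complex of the right-angled Coxeter group associated to $L$.
   Context: The Kneser complex $K(n,S)$ is the simplicial complex whose vertices are all subsets of $S$ of size $n$, and in which a collection of vertices spans a simplex if the corresponding subsets are pairwise disjoint. For a finite flag simplicial complex $L$, the right-angled Coxeter group is $W_L=\langle \xi\in L^{(0)}\mid \xi^2=1 \text{ for all }\xi\in L^{(0)},\ [\xi,\zeta]=1 \text{ whenever } \xi,\zeta \text{ are adjacent in } L\rangle$. The Davis complex $D(L)$ is the CAT(0) cube complex obtained from the Cayley graph of $W_L$ with respect to $L^{(0)}$ (with bigons coming from $\xi^2$ collapsed to single edges) by adding a cube whenever the 1-skeleton of a cube appears. $\mathrm{Aut}\,D(L)$ is its group of cube complex automorphisms. A group is virtually simple if it has a simple subgroup of finite index. *)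

(* Defs.v *)
From HB Require Import structures.
From mathcomp Require Import all_boot.
From mathcomp Require Import boolp.

Set Implicit Arguments.
Unset Strict Implicit.
Unset Printing Implicit Defensive.

Local Open Scope quotient_scope.
Local Open Scope group_scope.

(* The empty simplex is allowed. *)
Record simplicialComplex := SimplicialComplex {
  vertex :> finType;
  simplex : {set {set vertex}};
  simplex_vertex : forall v, [set v] \in simplex;
  simplex_face : forall s t : {set vertex},
    s \subset t -> t \in simplex -> s \in simplex
}.

Definition adjacent (L : simplicialComplex) (x y : L) :=
  (x != y) && ([set x; y] \in simplex L).

Definition flag (L : simplicialComplex) := forall s : {set L},
  {in s &, forall x y, x != y -> adjacent x y} -> s \in simplex L.

Section Kneser.
Variables (n : nat) (S : finType).

Definition kneserVertex := {A : {set S} | #|A| == n}.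

Definition kneser_simplex : {set {set kneserVertex}} :=
  [set s : {set kneserVertex} |
    [forall A in s, forall B in s, (A != B) ==> [disjoint val A & val B]]].

Fact kneser_simplex_vertex v : [set v] \in kneser_simplex.
Proof.
rewrite inE; apply/forall_inP => A /set1P->; apply/forall_inP => B /set1P->.
by rewrite eqxx.
Qed.

Fact kneser_simplex_face (s t : {set kneserVertex}) :
  s \subset t -> t \in kneser_simplex -> s \in kneser_simplex.
Proof.
move=> /subsetP st; rewrite !inE => /forall_inP Ht.
apply/forall_inP => A As; apply/forall_inP => B Bs.
by move/forall_inP: (Ht A (st A As)); apply; exact: st.
Qed.

Definition kneser : simplicialComplex :=
  SimplicialComplex kneser_simplex_vertex kneser_simplex_face.

Fact kneser_flag : flag kneser.
Proof.
move=> s sP; rewrite inE; apply/forall_inP => A As; apply/forall_inP => B Bs.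
apply/implyP => AB; have /andP[_] := sP A B As Bs AB.
rewrite inE => /forall_inP/(_ A); rewrite !inE eqxx => /(_ isT).
by move=> /forall_inP/(_ B); rewrite !inE eqxx orbT AB => /(_ isT).
Qed.

End Kneser.

(* Letters of the words in the generators X and their formal inverses:
   (x, false) stands for x and (x, true) for its inverse. *)
Section Presentation.
Variables (X : choiceType) (R : seq (X * bool) -> Prop).
Implicit Types u v w : seq (X * bool).

(* Equality of words in the group presented by <X | R>. *)
Inductive pres_eq : seq (X * bool) -> seq (X * bool) -> Prop :=
| pres_refl w : pres_eq w w
| pres_sym u v : pres_eq u v -> pres_eq v u
| pres_trans u v w : pres_eq u v -> pres_eq v w -> pres_eq u w
| pres_cat u u' v v' :
    pres_eq u u' -> pres_eq v v' -> pres_eq (u ++ v) (u' ++ v')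
| pres_cancel x b : pres_eq [:: (x, b); (x, ~~ b)] [::]
| pres_relator w : R w -> pres_eq w [::].

Definition pres_eqb : rel (seq (X * bool)) := fun u v => `[< pres_eq u v >].

Fact pres_eqb_refl : reflexive pres_eqb.
Proof. by move=> w; apply/asboolP; exact: pres_refl. Qed.

Fact pres_eqb_sym : symmetric pres_eqb.
Proof. by move=> u v; apply/asboolP/asboolP; exact: pres_sym. Qed.

Fact pres_eqb_trans : transitive pres_eqb.
Proof.
by move=> v u w /asboolP uv /asboolP vw; apply/asboolP; exact: pres_trans vw.
Qed.

Canonical pres_equiv := EquivRel pres_eqb
  pres_eqb_refl pres_eqb_sym pres_eqb_trans.

Definition presentedGroup := {eq_quot pres_equiv}.
HB.instance Definition _ := Choice.on presentedGroup.

Definition pres_class w : presentedGroup := \pi_({eq_quot pres_equiv}) w.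
Definition pres_repr (g : presentedGroup) : seq (X * bool) :=
  repr (g : {eq_quot pres_equiv}).

Fact pres_classP u v : pres_class u = pres_class v <-> pres_eq u v.
Proof.
by split => [/eqmodP/asboolP//|uv]; apply/eqmodP/asboolP.
Qed.

Fact pres_reprK : cancel pres_repr pres_class.
Proof. by move=> g; exact: reprK. Qed.

Definition word_inv w := rev [seq (p.1, ~~ p.2) | p <- w].

Definition pres_one : presentedGroup := pres_class [::].
Definition pres_mul (g h : presentedGroup) : presentedGroup :=
  pres_class (pres_repr g ++ pres_repr h).
Definition pres_inv (g : presentedGroup) : presentedGroup :=
  pres_class (word_inv (pres_repr g)).

Fact pres_class_cat u v :
  pres_class (u ++ v) = pres_mul (pres_class u) (pres_class v).
Proof.
by apply/pres_classP/pres_cat; apply/pres_classP; rewrite pres_reprK.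
Qed.

Fact pres_mulA : associative pres_mul.
Proof.
move=> g h k; rewrite -(pres_reprK g) -(pres_reprK h) -(pres_reprK k).
by rewrite -!pres_class_cat catA.
Qed.

Fact pres_mul1 : left_id pres_one pres_mul.
Proof. by move=> g; rewrite -(pres_reprK g) -pres_class_cat. Qed.

Fact pres_mulr1 : right_id pres_one pres_mul.
Proof. by move=> g; rewrite -(pres_reprK g) -pres_class_cat cats0. Qed.

Fact word_inv_cons x b w : word_inv ((x, b) :: w) = word_inv w ++ [:: (x, ~~ b)].
Proof. by rewrite /word_inv /= rev_cons cats1. Qed.

Fact word_invK : involutive word_inv.
Proof.
move=> w; rewrite /word_inv map_rev revK -map_comp.
by rewrite -[RHS]map_id; apply: eq_map => -[x b] /=; rewrite negbK.
Qed.

Fact word_mulV w : pres_eq (w ++ word_inv w) [::].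
Proof.
elim: w => [|[x b] w IHw]; first exact: pres_refl.
rewrite word_inv_cons catA; apply: (pres_trans _ (pres_cancel x b)).
rewrite -/([:: _] ++ [:: (x, ~~ b)]) -[((x, b) :: w) ++ _]/([:: (x, b)] ++ _).
apply: pres_cat; last exact: pres_refl.
rewrite -[X in pres_eq _ X]cats0; apply: pres_cat IHw; exact: pres_refl.
Qed.

Fact pres_mulrV : right_inverse pres_one pres_inv pres_mul.
Proof.
move=> g; rewrite -{1}(pres_reprK g) -pres_class_cat.
by apply/pres_classP; exact: word_mulV.
Qed.

Fact pres_mulV : left_inverse pres_one pres_inv pres_mul.
Proof.
move=> g; rewrite -{2}(pres_reprK g) -pres_class_cat; apply/pres_classP.
by rewrite -{2}(word_invK (pres_repr g)); exact: word_mulV.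
Qed.

HB.instance Definition _ := isGroup.Build presentedGroup
  pres_mulA pres_mul1 pres_mulr1 pres_mulV pres_mulrV.

Definition pres_gen (x : X) : presentedGroup := pres_class [:: (x, false)].

End Presentation.

(* The relators depend only on the 1-skeleton of L, which determines L when L
   is flag. *)
Inductive racg_relator (L : simplicialComplex) : seq (L * bool) -> Prop :=
| racg_square x : racg_relator [:: (x, false); (x, false)]
| racg_commutator x y : adjacent x y ->
    racg_relator [:: (x, true); (y, true); (x, false); (y, false)].

Definition racg (L : simplicialComplex) : groupType :=
  presentedGroup (@racg_relator L).

Definition racg_gen (L : simplicialComplex) (x : L) : racg L :=
  pres_gen (@racg_relator L) x.

(* Simple graph: bigons arising from involutive generators are single edges. *)
Definition cayley_adj (L : simplicialComplex) (g h : racg L) : Prop :=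
  exists x : L, h = g * racg_gen x.

(* Vertices of the k-cube [0,1]^k, and the adjacency of its 1-skeleton. *)
Definition cubeVertex (k : nat) := {ffun 'I_k -> bool}.

Definition cube_adj (k : nat) (a b : cubeVertex k) : Prop :=
  #|[set i | a i != b i]| = 1%N.

(* A k-cube is given by its characteristic map on vertices, so that each cube
   appears once for each of its parametrizations. Injective maps between
   cubes that preserve adjacency are the inclusions of faces, composed with
   symmetries of cubes. *)
Record cubeComplex := CubeComplex {
  cvertex :> Type;
  is_cube : forall k, (cubeVertex k -> cvertex) -> Prop;
  cube_inj : forall k (phi : cubeVertex k -> cvertex),
    is_cube phi -> injective phi;
  cube_point : forall v, @is_cube 0 (fun=> v);
  cube_face : forall j k (phi : cubeVertex k -> cvertex)
      (iota : cubeVertex j -> cubeVertex k),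
    injective iota -> (forall a b, cube_adj a b -> cube_adj (iota a) (iota b)) ->
    is_cube phi -> is_cube (phi \o iota)
}.

Section Cubulation.
Variables (V : Type) (E : V -> V -> Prop).

(* A copy of the 1-skeleton of the k-cube in the graph (V, E). *)
Definition cube_skeleton k (phi : cubeVertex k -> V) : Prop :=
  injective phi /\ forall a b, cube_adj a b -> E (phi a) (phi b).

Fact cube_skeleton_inj k (phi : cubeVertex k -> V) :
  cube_skeleton phi -> injective phi.
Proof. by case. Qed.

Fact cube_skeleton_point v : @cube_skeleton 0 (fun=> v).
Proof.
split=> [a b _|a b]; first by apply/ffunP => -[].
by rewrite /cube_adj eq_card0 // => -[].
Qed.

Fact cube_skeleton_face j k (phi : cubeVertex k -> V)
    (iota : cubeVertex j -> cubeVertex k) :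
  injective iota -> (forall a b, cube_adj a b -> cube_adj (iota a) (iota b)) ->
  cube_skeleton phi -> cube_skeleton (phi \o iota).
Proof.
move=> ij ia [pj pa]; split; first exact: inj_comp.
by move=> a b ab; exact/pa/ia.
Qed.

Definition cubulation : cubeComplex :=
  CubeComplex cube_skeleton_inj cube_skeleton_point cube_skeleton_face.

End Cubulation.

Definition davis (L : simplicialComplex) : cubeComplex :=
  cubulation (@cayley_adj L).

(* A bijection of the vertices carrying cubes to cubes in both directions
   extends uniquely to an automorphism that is affine on each cube. *)
Record cubeAut (D : cubeComplex) := CubeAut {
  aut_fun :> D -> D;
  aut_inv : D -> D;
  aut_funK : cancel aut_fun aut_inv;
  aut_invK : cancel aut_inv aut_fun;
  aut_cube : forall k (phi : cubeVertex k -> D),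
    is_cube (aut_fun \o phi) <-> is_cube phi
}.

Section CubeAutGroup.
Variable D : cubeComplex.
Implicit Types f g h : cubeAut D.

Fact cubeAut_eq f g : f =1 g -> f = g.
Proof.
case: f g => f f' fK f'K fP [g g' gK g'K gP] /= /funext fg; subst g.
have /funext e : f' =1 g' by move=> x; rewrite -{1}(g'K x) fK.
by subst g'; congr CubeAut; exact: Prop_irrelevance.
Qed.

HB.instance Definition _ := gen_eqMixin (cubeAut D).
HB.instance Definition _ := gen_choiceMixin (cubeAut D).

Definition aut_one : cubeAut D :=
  @CubeAut D id id (fun=> erefl) (fun=> erefl) (fun _ _ => iff_refl _).

Fact aut_mul_cube f g k (phi : cubeVertex k -> D) :
  is_cube ((f \o g) \o phi) <-> is_cube phi.
Proof. exact: iff_trans (aut_cube f (g \o phi)) (aut_cube g phi). Qed.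

Definition aut_mul f g : cubeAut D :=
  CubeAut (can_comp (aut_funK f) (aut_funK g))
          (can_comp (aut_invK g) (aut_invK f)) (aut_mul_cube f g).

Fact aut_opp_cube f k (phi : cubeVertex k -> D) :
  is_cube (aut_inv f \o phi) <-> is_cube phi.
Proof.
apply: iff_trans (iff_sym (aut_cube f _)) _.
rewrite (_ : f \o (aut_inv f \o phi) = phi) //.
by apply/funext => a /=; rewrite aut_invK.
Qed.

Definition aut_opp f : cubeAut D :=
  CubeAut (aut_invK f) (aut_funK f) (aut_opp_cube f).

Fact aut_mulA : associative aut_mul.
Proof. by move=> f g h; exact: cubeAut_eq. Qed.
Fact aut_mul1 : left_id aut_one aut_mul.
Proof. by move=> f; exact: cubeAut_eq. Qed.
Fact aut_mulr1 : right_id aut_one aut_mul.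
Proof. by move=> f; exact: cubeAut_eq. Qed.
Fact aut_mulV : left_inverse aut_one aut_opp aut_mul.
Proof. by move=> f; apply: cubeAut_eq => v; exact: aut_funK. Qed.
Fact aut_mulrV : right_inverse aut_one aut_opp aut_mul.
Proof. by move=> f; apply: cubeAut_eq => v; exact: aut_invK. Qed.

HB.instance Definition _ := isGroup.Build (cubeAut D)
  aut_mulA aut_mul1 aut_mulr1 aut_mulV aut_mulrV.

End CubeAutGroup.

Section VirtuallySimple.
Variable G : groupType.
Implicit Types H N : {pred G}.

Definition normal_in N H : Prop :=
  [/\ group_closed N, {subset N <= H} & {in H & N, forall h x, x ^ h \in N}].

Definition simple_subgroup H : Prop :=
  [/\ group_closed H,
      exists2 x, x \in H & x != 1 &
      forall N, normal_in N H -> N =i pred1 1 \/ N =i H].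

(* Finitely many left cosets x H cover G. *)
Definition finite_index H : Prop :=
  exists s : seq G, forall g, exists2 x, x \in s & x^-1 * g \in H.

Definition virtually_simple : Prop :=
  exists2 H : {pred G}, simple_subgroup H & finite_index H.

End VirtuallySimple.

(* Main.v *)
Require Import Defs.
From HB Require Import structures.
From mathcomp Require Import all_boot perm.
From mathcomp Require Import ssralg ssrnum ssrint zify.
From mathcomp Require Import boolp.

(** Write W for the right-angled Coxeter group, G for the automorphism group of
    its Davis complex, and H for the subgroup of G generated by the
    automorphisms that fix a half-space pointwise. The claim is that H has
    finite index in G and that H is simple, by Tits's argument for trees. The
    only properties of the Kneser complex involved are those of the record
    star_flexible. They come from the fact that a permutation of the points of
    an n-set A fixes A and every n-set disjoint from A, hence the star of A,
    and moves other n-sets as 2 <= n < n * d + 1.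

    An automorphism f permutes L at every vertex w: this is its local action.
    Crossing an edge labelled x changes the local action only off the star of
    x, and conversely every family of permutations with this property is the
    portrait of an automorphism (portrait_aut). So portraits can be altered
    freely in a half-space, or pulled back along maps of W that send edges to
    vertices or to edges with the same label.

    Finite index. Pulling a portrait back along the map that pushes the
    half-space of x into its wall changes it by an element supported in that
    half-space; finitely many such maps compose to the constant map 1, so an
    automorphism that fixes the star of 1 lies in H (local1_generated). The
    permutations of L fixing a star and the connectedness of the Johnson graph
    put all translations by words of even length into H (even_generated).
    Hence an automorphism is known modulo H from a parity and from a
    permutation of the finite set of vertices of L (half_finite_index).

    Simplicity. A non-trivial normal subgroup N of H has an element that maps
    some half-space off itself (displace_ex): if g does not do so, then its
    commutator with a twist supported in a well-chosen half-space has a fixed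
    vertex next to a moved one, where the half-spaces are easily followed. Two
    conjugates of this element, for half-spaces that cover W, have a product t
    in N that shrinks a half-space E. If u is supported in a half-space inside
    E and outside t E, the infinite product u' of the conjugates of u by the
    powers of t lies in H and u is the commutator of u' and t, so u is in N
    (tits_commutator). Finally H carries every half-space into any given one,
    so all generators of H lie in N.

    The geometry of half-spaces rests on two facts about W: the half-spaces of
    two non-adjacent generators are disjoint (half_indep), and an element that
    commutes with x lies, up to x, in the subgroup generated by the vertices
    adjacent to x (centralizer_word). *)

Set Implicit Arguments.
Unset Strict Implicit.
Unset Printing Implicit Defensive.
Import GRing.Theory.
Local Open Scope group_scope.

(** * Words and actions of right-angled Coxeter groups *)

Section Racg.
Variable L : simplicialComplex.
Local Notation W := (racg L).
Local Notation gen := (@racg_gen L).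
Implicit Types (x y z : L) (s : seq L) (g h w : W).

Lemma adjacent_sym x y : adjacent x y = adjacent y x.
Proof. by rewrite /adjacent eq_sym setUC. Qed.

Lemma adjacent_irr x : adjacent x x = false.
Proof. by rewrite /adjacent eqxx. Qed.

Lemma racg_genK x : gen x * gen x = 1.
Proof.
apply: (@etrans _ _ (pres_class (@racg_relator L) [:: (x, false); (x, false)])).
  by rewrite -[[:: _; _]]/([:: (x, false)] ++ [:: (x, false)]) pres_class_cat.
by apply/pres_classP/pres_relator; constructor.
Qed.

Lemma racg_genV x : (gen x)^-1 = gen x.
Proof. exact/mulg1_eq/racg_genK. Qed.

Lemma mul_gen_genK x g : gen x * (gen x * g) = g.
Proof. by rewrite mulgA racg_genK mul1g. Qed.

Lemma mul_gen_genKr x g : g * gen x * gen x = g.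
Proof. by rewrite -mulgA racg_genK mulg1. Qed.

Lemma pres_class_letter x b : pres_class (@racg_relator L) [:: (x, b)] = gen x.
Proof.
case: b => //; rewrite -racg_genV; apply/esym/mulg1_eq.
apply: (@etrans _ _ (pres_class (@racg_relator L) [:: (x, false); (x, true)])).
  by rewrite -[[:: _; _]]/([:: (x, false)] ++ [:: (x, true)]) pres_class_cat.
exact/pres_classP/(pres_cancel _ x false).
Qed.

Lemma racg_genC x y : adjacent x y -> gen x * gen y = gen y * gen x.
Proof.
move=> xy; apply: divg1_eq; rewrite invgM !racg_genV.
have /pres_classP : pres_eq (@racg_relator L)
  [:: (x, true); (y, true); (x, false); (y, false)] [::].
  by apply: pres_relator; constructor.
rewrite -[[:: _; _; _; _]]/([:: (x, true)] ++ [:: (y, true)]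
  ++ [:: (x, false)] ++ [:: (y, false)]) !pres_class_cat !pres_class_letter.
by rewrite -mulgA.
Qed.

Fixpoint word s : W := if s is x :: s' then gen x * word s' else 1.

Lemma word_cat s t : word (s ++ t) = word s * word t.
Proof. by elim: s => [|x s IH] /=; rewrite ?mul1g // IH mulgA. Qed.

Lemma word_rcons s x : word (rcons s x) = word s * gen x.
Proof. by rewrite -cats1 word_cat /= mulg1. Qed.

Lemma wordP w : exists s, w = word s.
Proof.
rewrite -(pres_reprK w); exists [seq p.1 | p <- pres_repr w].
elim: (pres_repr w) => [|[x b] s IH] //=.
by rewrite -cat1s pres_class_cat pres_class_letter IH.
Qed.

Lemma racg_ind (P : W -> Prop) :
  P 1 -> (forall w x, P w -> P (w * gen x)) -> forall w, P w.
Proof.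
move=> P1 PM w; have [s ->] := wordP w.
by elim/last_ind: s => // s x; rewrite word_rcons; exact: PM.
Qed.

(** A family of commuting involutions indexed by L defines a right action of
    the group; every homomorphism and cocycle below is obtained by running a
    word through such a family. *)
Section Run.
Variables (X : Type) (step : L -> X -> X).

Definition racg_steps : Prop :=
  (forall x, involutive (step x)) /\
  (forall x y a, adjacent x y -> step y (step x a) = step x (step y a)).

Definition run (a : X) w : X := foldl (fun a p => step p.1 a) a (pres_repr w).

Hypothesis stepP : racg_steps.

Let run_pres_eq u v : pres_eq (@racg_relator L) u v ->
  forall a : X, foldl (fun a p => step p.1 a) a u
              = foldl (fun a p => step p.1 a) a v.
Proof.
have [sK sC] := stepP.
elim=> [//|{}u {}v _ IH|{}u {}v w _ IH1 _ IH2|{}u u' {}v v' _ IH1 _ IH2|x b|w].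
- by move=> a; rewrite IH.
- by move=> a; rewrite IH1 IH2.
- by move=> a; rewrite !foldl_cat IH1 IH2.
- by move=> a; exact: sK.
by case=> [x a|x y xy a] /=; rewrite ?sK // sC // sK sK.
Qed.

Lemma run1 a : run a 1 = a.
Proof.
rewrite /run (@run_pres_eq _ [::]) //.
by apply/pres_classP; rewrite pres_reprK.
Qed.

Lemma run_gen a w x : run a (w * gen x) = step x (run a w).
Proof.
rewrite /run (@run_pres_eq _ (pres_repr w ++ [:: (x, false)])).
  by rewrite foldl_cat.
by apply/pres_classP; rewrite pres_reprK pres_class_cat pres_reprK.
Qed.

Lemma run_word a s : run a (word s) = foldl (fun a x => step x a) a s.
Proof.
elim/last_ind: s => [|s x IH]; first by rewrite run1.
by rewrite word_rcons run_gen IH -cats1 foldl_cat.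
Qed.

End Run.

(** * Finite quotients of the group *)

(* The state is the parity of the number of occurrences of each generator, so
   that running a word computes its class in the abelianisation. *)
Let flip x (c : L -> bool) : L -> bool := fun y => c y (+) (y == x).
Let flip_steps : racg_steps flip.
Proof.
split=> [x c|x y c _]; apply/funext => z; rewrite /flip.
  by rewrite -addbA addbb addbF.
by rewrite -!addbA [(z == x) (+) _]addbC.
Qed.

Lemma racg_parity :
  exists f : W -> L -> bool, f 1 = (fun _ => false) /\
    forall w x y, f (w * gen x) y = f w y (+) (y == x).
Proof.
exists (run flip (fun _ => false)); rewrite run1; last exact: flip_steps.
by split=> // w x y; rewrite run_gen; last exact: flip_steps.
Qed.

(** The abelianisation already shows that two edge paths of length two with the
    same ends use the same labels, unless they backtrack. *)
Lemma gen2_eq x y z t : gen x * gen y = gen z * gen t ->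
  [/\ x = y & z = t] \/ [/\ x = z & y = t] \/ [/\ x = t & y = z].
Proof.
have [f [f1 fM]] := racg_parity.
move=> e; have {}e u : (u == x) (+) (u == y) = (u == z) (+) (u == t).
  have := congr1 (fun w => f w u) e.
  by rewrite -[gen x]mul1g -[gen z]mul1g !fM f1.
have [xy|xy] := eqVneq x y.
  left; split=> //; have := e z; rewrite xy addbb eqxx /=.
  by case: eqVneq.
right; have [xz|xz] := eqVneq x z.
  left; split=> //; have := e y; rewrite xz => /addbI.
  by rewrite eqxx => /esym/eqP.
have xt : x = t.
  have := e x; rewrite eqxx (negPf xy) (negPf xz) /=.
  by case: eqVneq.
right; split=> //; have := e y; rewrite xt addbC => /addIb.
by rewrite eqxx => /esym/eqP.
Qed.

Lemma gen_inj : injective gen.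
Proof.
move=> x y e; have : gen x * gen x = gen x * gen y by rewrite e.
by case/gen2_eq => -[] // -[].
Qed.

Lemma gen_neq1 x : gen x <> 1.
Proof.
have [f [f1 fM]] := racg_parity => /(congr1 (fun w => f w x)).
by rewrite -[gen x]mul1g fM f1 eqxx.
Qed.

Lemma conj_gen_eq x y w : gen x ^ w = gen y -> x = y.
Proof.
have [f [f1 fM]] := racg_parity.
have fMM u v z : f (u * v) z = f u z (+) f v z.
  elim/racg_ind: v => [|v t IH]; first by rewrite mulg1 f1 addbF.
  by rewrite mulgA !fM IH addbA.
have fg z t : f (gen z) t = (t == z) by rewrite -[gen z]mul1g fM f1.
move/(congr1 (fun g => w * g)); rewrite conjgE mulVKg.
move/(congr1 (fun g => f g x)); rewrite !fMM addbC => /addbI.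
by rewrite !fg eqxx => /esym/eqP.
Qed.

Lemma gen_comm_adj x y :
  x != y -> gen x * gen y = gen y * gen x -> adjacent x y.
Proof.
(* Were x and y not adjacent, they could act on three points as two distinct
   transpositions, all other generators acting trivially. *)
move=> xy e; apply: contraT => nadj; exfalso.
pose tr z (a : option bool) : option bool :=
  if z == x then (if a == Some true then None else if a == None then Some true
                  else a)
  else if z == y then (if a == Some false then None
                       else if a == None then Some false else a)
  else a.
have trP : racg_steps tr.
  split=> [z|z t a zt]; first by case=> [[]|]; rewrite /tr; do 2!case: eqP.
  rewrite /tr; have := nadj; case: (eqVneq z x) zt => [->|zx].
    case: (eqVneq t x) => [-> //|_].
    by case: (eqVneq t y) => [->->|].
  case: (eqVneq z y) => [->|zy] //.
  by case: (eqVneq t x) => [->|_]; [rewrite adjacent_sym => ->|case: eqP].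
have := congr1 (run tr None) e.
rewrite !run_gen // -[gen x]mul1g -[gen y]mul1g !run_gen // !run1 //.
by rewrite /tr !eqxx [y == x]eq_sym (negPf xy).
Qed.

End Racg.


(** * Walls and half-spaces *)

Section Walls.
Variable L : simplicialComplex.
Local Notation W := (racg L).
Local Notation gen := (@racg_gen L).
Implicit Types (x y z : L) (s : seq L) (g h w r : W).

Let wall_step x (p : W * bool) : W * bool :=
  (gen x * p.1 * gen x, p.2 (+) (p.1 == gen x)).

Let conj_gen_eqE x y c : gen x * c * gen x = gen y <-> c = gen x * gen y * gen x.
Proof. by split=> [<-|->]; rewrite -!mulgA racg_genK mulg1 mul_gen_genK. Qed.

Let wall_steps : racg_steps wall_step.
Proof.
split=> [x [c e]|x y [c e] xy]; rewrite /wall_step /=; congr (_, _).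
- by rewrite !mulgA racg_genK mul1g mul_gen_genKr.
- rewrite -addbA (_ : (_ * _ * _ == _) = (c == gen x)) ?addbb ?addbF //.
  apply/eqP/eqP; first by move/conj_gen_eqE; rewrite racg_genK mul1g.
  by move->; rewrite racg_genK mul1g.
- by rewrite !mulgA (racg_genC xy) -!mulgA (racg_genC xy).
have xyx : gen x * gen y * gen x = gen y by rewrite (racg_genC xy) mul_gen_genKr.
have yxy : gen y * gen x * gen y = gen x by rewrite -(racg_genC xy) mul_gen_genKr.
rewrite (_ : (gen x * c * gen x == gen y) = (c == gen y)); last first.
  by apply/eqP/eqP => [/conj_gen_eqE|] ->.
rewrite (_ : (gen y * c * gen y == gen x) = (c == gen x)) 1?addbAC //.
by apply/eqP/eqP => [/conj_gen_eqE|] ->.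
Qed.

(** The inversion cocycle of the Coxeter group: it tells whether the wall of
    the reflection r separates 1 from w. Running it along a path, by adding the
    crossings of the successive edges, makes it well defined without any theory
    of reduced words. *)
Definition crosses r w : bool := (run wall_step (r, false) w).2.

Let run_wall r w : run wall_step (r, false) w = (r ^ w, crosses r w).
Proof.
rewrite [LHS]surjective_pairing; congr pair.
elim/racg_ind: w => [|w x IH]; first by rewrite run1 // conjg1.
by rewrite run_gen // /= IH conjgM [RHS]conjgE racg_genV [RHS]mulgA.
Qed.

Lemma crosses1 r : crosses r 1 = false.
Proof. by rewrite /crosses run1. Qed.

Lemma crosses_gen r w x :
  crosses r (w * gen x) = crosses r w (+) (r ^ w == gen x).
Proof. by rewrite {1}/crosses run_gen // run_wall. Qed.

Lemma crossesM r g h : crosses r (g * h) = crosses r g (+) crosses (r ^ g) h.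
Proof.
elim/racg_ind: h => [|h x IH]; first by rewrite mulg1 crosses1 addbF.
by rewrite mulgA !crosses_gen IH conjgM addbA.
Qed.

(** The half-space bounded by the wall of the generator x that does not
    contain 1; its elements are those with a reduced word beginning with x. *)
Definition half x w : bool := crosses (gen x) w.

Lemma half1 x : half x 1 = false.
Proof. exact: crosses1. Qed.

Lemma half_gen x w y : half x (w * gen y) = half x w (+) (gen x ^ w == gen y).
Proof. exact: crosses_gen. Qed.

Lemma crosses_genl r x w :
  crosses r (gen x * w) = (r == gen x) (+) crosses (r ^ gen x) w.
Proof.
by rewrite crossesM -{1}[gen x]mul1g crosses_gen crosses1 conjg1.
Qed.

Lemma half_genl x w : half x (gen x * w) = ~~ half x w.
Proof.
by rewrite /half crosses_genl eqxx (_ : gen x ^ gen x = gen x) // conjgE mulKg.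
Qed.

Lemma half_adjl x y w : adjacent x y -> half y (gen x * w) = half y w.
Proof.
move=> xy; rewrite /half crosses_genl (inj_eq (@gen_inj L)) eq_sym.
case/andP: (xy) => /negPf-> _ /=.
by rewrite conjgE racg_genV -(racg_genC xy) mul_gen_genK.
Qed.

(** Crossing the wall means that w conjugates x to y, which forces x = y in the
    abelianisation. *)
Lemma half_edge x y w : half x (w * gen y) != half x w ->
  [/\ x = y & w * gen x = gen x * w].
Proof.
rewrite half_gen; case: (gen x ^ w =P gen y) => [e _|_]; last by rewrite addbF eqxx.
have xy := conj_gen_eq e; split=> //; rewrite {1}xy -e conjgE mulVKg //.
Qed.

(** Exchange: if the wall of r separates 1 from the end of a path, reflecting
    the part of the path beyond the wall shortens it by one edge. *)
Lemma exchange r s : crosses r (word s) ->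
  exists2 t, subseq t s & size s = (size t).+1 /\ r * word s = word t.
Proof.
elim/last_ind: s => [|s x IH]; first by rewrite /= crosses1.
rewrite word_rcons crosses_gen; case: (boolP (crosses r (word s))) => [rs _|_ /=].
  have [t ts [st e]] := IH rs; exists (rcons t x).
    by rewrite -!cats1 cat_subseq.
  by rewrite !size_rcons st mulgA e word_rcons.
move=> /eqP e; exists s; first exact: subseq_rcons.
rewrite size_rcons; split=> //; rewrite mulgA (_ : r * _ = word s * gen x).
  exact: mul_gen_genKr.
by rewrite -e conjgE mulVKg.
Qed.

(** * Disjointness of the half-spaces of two non-adjacent generators *)

Definition indep x y := (x != y) && ~~ adjacent x y.

Lemma indep_sym x y : indep x y = indep y x.
Proof. by rewrite /indep eq_sym adjacent_sym. Qed.

Fixpoint alt x y k : seq L := if k is k'.+1 then x :: alt y x k' else [::].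

Lemma alt_rcons x y k :
  alt x y k.+1 = rcons (alt x y k) (if odd k then y else x).
Proof.
elim: k x y => [//|k IH] x y.
by rewrite -[LHS]/(x :: alt y x k.+1) IH /=; case: (odd k).
Qed.

(** The two generators act on the integers as the reflections of an infinite
    dihedral group; a state (e, m) stands for the map t |-> m + t or m - t. *)
Lemma alt_neq x y k : indep x y -> word (alt x y k.+1) <> word (alt y x k.+1).
Proof.
move=> /andP[xy nadj].
pose step z (p : bool * int) : bool * int :=
  if z == x then (~~ p.1, p.2)
  else if z == y then (~~ p.1, if p.1 then (p.2 - 1)%R else (p.2 + 1)%R) else p.
have stepP : racg_steps step.
  split=> [z [e m]|z t a zt]; rewrite /step.
    case: (z == x) => /=; first by rewrite negbK.
    by case: (z == y) => //=; rewrite negbK; case: e; congr pair; lia.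
  have := nadj; case: (eqVneq z x) zt => [->|zx].
    case: (eqVneq t x) => [-> //|_].
    by case: (eqVneq t y) => [->->|].
  case: (eqVneq z y) => [->|zy] //.
  by case: (eqVneq t x) => [->|_]; [rewrite adjacent_sym => ->|case: eqP].
have stepx : step x =1 fun p => (~~ p.1, p.2) by move=> p; rewrite /step eqxx.
have stepy : step y =1
    fun p => (~~ p.1, if p.1 then (p.2 - 1)%R else (p.2 + 1)%R).
  by move=> p; rewrite /step eq_sym (negPf xy) eqxx.
have run_alt j : forall m : int,
   [/\ ((run step (false, m) (word (alt x y j))).2 <= m)%R,
       ((run step (true, m) (word (alt y x j))).2 <= m)%R,
       (m <= (run step (true, m) (word (alt x y j))).2)%R
     & (m <= (run step (false, m) (word (alt y x j))).2)%R].
  elim: j => [m|j IH m]; first by rewrite !run1.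
  rewrite !run_word //= -!run_word // !stepx !stepy /=.
  have [_ a _ b] := IH m; have [c _ _ _] := IH (m - 1)%R.
  by have [_ _ d _] := IH (m + 1)%R; split; lia.
move/(congr1 (fun w => (run step (false, 0%R) w).2)).
have [a _ _ _] := run_alt k.+1 0%R; have [_ _ b _] := run_alt k 1%R.
rewrite [in RHS]run_word //= -run_word // stepy /= add0r => e.
by move: a; rewrite e; lia.
Qed.

Lemma half_alt x y k : indep x y -> half y (word (alt x y k)) = false.
Proof.
move=> xy; elim: k => [|k IH]; first exact: half1.
rewrite alt_rcons word_rcons half_gen IH /=; apply/negP => /eqP e.
apply: (@alt_neq x y k xy); rewrite alt_rcons word_rcons -e conjgE mulVKg.
by rewrite (_ : gen y * _ = word (alt y x k.+1)).
Qed.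

Let dihedral x y w := exists k, w = word (alt x y k) \/ w = word (alt y x k).

Let dihedral_gen x y w : dihedral x y w -> dihedral x y (gen x * w).
Proof.
case=> -[|k] [] ->; rewrite /= ?mul_gen_genK.
- by exists 1%N; left.
- by exists 1%N; left.
- by exists k; right.
by exists k.+2; left.
Qed.

Let dihedral_sym x y w : dihedral x y w -> dihedral y x w.
Proof. by case=> k [] ->; exists k; [right|left]. Qed.

Let dihedralM x y g h : dihedral x y g -> dihedral x y h -> dihedral x y (g * h).
Proof.
move=> [k]; elim: k x y g => [|k IH] x y g.
  by case=> -> /= hh; rewrite mul1g.
case=> -> /= hh; rewrite -mulgA; [|apply: dihedral_sym].
  by apply/dihedral_gen/dihedral_sym/(IH y x _ (or_introl erefl))/dihedral_sym.
by apply/dihedral_gen/dihedral_sym/(IH x y _ (or_introl erefl)).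
Qed.

Let dihedralV x y g : dihedral x y g -> dihedral x y g^-1.
Proof.
have d1 a b : dihedral a b (gen a) by exists 1%N; left; rewrite /= mulg1.
move=> [k]; elim: k x y g => [|k IH] x y g.
  by case=> ->; exists 0%N; left; rewrite invg1.
case=> -> /=; rewrite invgM racg_genV; apply: dihedralM.
- exact/dihedral_sym/IH/or_introl.
- exact: d1.
- exact/IH/or_introl.
exact/dihedral_sym.
Qed.

(** Splitting w as d * v with d in the dihedral subgroup and v of minimal
    length, no wall of a reflection of the subgroup crosses v; so the position
    of w with respect to the walls of x and y is that of d. *)
Lemma half_indep x y w : indep x y -> half x w -> half y w = false.
Proof.
move=> xy.
have [d [v [dd -> vP]]] : exists d v, [/\ dihedral x y d, w = d * v
    & forall r, dihedral x y r -> crosses r v = false].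
  have [s ->] := wordP w; have [m] := ubnP (size s).
  elim: m s => // m IH s /ltnSE sm.
  have [[r [dr /exchange[t _ [st e]]]]|none] :=
      pselect (exists r, dihedral x y r /\ crosses r (word s)).
    have [|d [v [dd ev vP]]] := IH t; first by rewrite -ltnS -st ltnS.
    exists (r^-1 * d), v; split=> //; first exact/dihedralM/dd/dihedralV.
    by rewrite -mulgA -ev -e mulKg.
  exists 1, (word s); split; first by exists 0%N; left.
    by rewrite mul1g.
  by move=> r dr; apply/negP => cr; apply: none; exists r.
have dx : dihedral x y (gen x) by exists 1%N; left; rewrite /= mulg1.
have dy : dihedral x y (gen y) by exists 1%N; right; rewrite /= mulg1.
have dJ r : dihedral x y r -> crosses r (d * v) = crosses r d.
  move=> dr; rewrite crossesM vP ?addbF // conjgE.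
  exact/dihedralM/dihedralM/dd/dr/dihedralV.
rewrite /half !dJ //; case: dd => k [] ->; first by move=> _; exact: half_alt.
by rewrite [crosses _ _]half_alt // indep_sym.
Qed.

(** Disjointness in the form in which it is used: chains of non-adjacent letters
    give chains of nested half-spaces. *)
Lemma half_nest x y w : indep x y -> half y w -> half x (gen x * w).
Proof.
by move=> xy yw; rewrite half_genl (@half_indep y x) // indep_sym.
Qed.

(** * Retractions onto special subgroups and centralisers of generators *)

Section Retraction.
Variable T : {pred L}.

Let retr_step x w : W := if x \in T then w * gen x else w.

Let retr_steps : racg_steps retr_step.
Proof.
split=> [x w|x y w xy]; rewrite /retr_step; case: (x \in T) => //.
  exact: mul_gen_genKr.
by case: (y \in T) => //; rewrite -!mulgA (racg_genC xy).
Qed.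

Definition retr w : W := run retr_step 1 w.

Lemma retr1 : retr 1 = 1.
Proof. exact: run1. Qed.

Lemma retr_gen w x : retr (w * gen x) = if x \in T then retr w * gen x else retr w.
Proof. exact: run_gen. Qed.

Lemma retr_word s : retr (word s) = word [seq x <- s | x \in T].
Proof.
elim/last_ind: s => [|s x IH]; first exact: retr1.
rewrite word_rcons retr_gen IH filter_rcons; case: ifP => // _.
by rewrite word_rcons.
Qed.

End Retraction.

Lemma shortest_word w :
  exists2 s, w = word s & forall t, w = word t -> size s <= size t.
Proof.
have [s ->] := wordP w; have [m] := ubnP (size s).
elim: m s => // m IH s /ltnSE sm.
have [[t [e ts]]|none] := pselect (exists t, word s = word t /\ size t < size s).
  by rewrite e; apply: IH; exact: leq_trans ts sm.
exists s => // t e; rewrite leqNgt; apply/negP => ts.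
by apply: none; exists t.
Qed.

Lemma shortest_half x s :
  (forall t, word (x :: s) = word t -> size s < size t) -> half x (word (x :: s)).
Proof.
move=> min; rewrite /= half_genl; apply/negP => /exchange[t _ [st e]].
by have := min _ e; rewrite st ltnNge leqnSn.
Qed.

Lemma half_neq1 w : w <> 1 -> exists x, half x w.
Proof.
have [[|x s] -> min] := shortest_word w; first by [].
by move=> _; exists x; exact: shortest_half.
Qed.

(** If y is the first letter of a shortest word for w, then w * x = x * w lies
    in the half-spaces of both x and y, so y is adjacent to x. *)
Lemma centralizer_word x w : w * gen x = gen x * w -> half x w = false ->
  exists2 s, w = word s & all (adjacent x) s.
Proof.
have [s -> min] := shortest_word w.
elim: s min => [|y s IH] min c nx; first by exists [::].
have ys := shortest_half min; set w0 := word (y :: s) in c nx ys.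
have xy : x != y by apply: contraTneq ys => <-; rewrite nx.
have adj : adjacent x y.
  apply: contraT => nadj; have ind : indep x y by rewrite /indep xy.
  have yx : half y (w0 * gen x) = false.
    by apply: (half_indep ind); rewrite c half_genl nx.
  have /half_edge[exy _] : half y (w0 * gen x) != half y w0 by rewrite yx ys.
  by rewrite exy eqxx in xy.
have e0 : word s = gen y * w0 by rewrite /w0 /= mul_gen_genK.
have [|||t e at_] := IH.
- move=> t e; have := min (y :: t); rewrite /= e => /(_ erefl).
  by rewrite ltnS.
- by rewrite e0 -mulgA c !mulgA (racg_genC adj).
- by rewrite e0 half_adjl // adjacent_sym.
by exists (y :: t); rewrite /= ?adj // -e.
Qed.

(** So along the wall of x the retraction onto the subgroup of the link of x is
    the identity. *)
Lemma retr_centralizer x w : w * gen x = gen x * w -> half x w = false ->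
  retr (adjacent x) w = w.
Proof.
move=> c nx; have [s -> /all_filterP e] := centralizer_word c nx.
by rewrite retr_word -[in RHS]e.
Qed.

End Walls.


(** * Automorphisms of the Davis complex and their local actions *)

Section Automorphisms.
Variable L : simplicialComplex.
Local Notation W := (racg L).
Local Notation gen := (@racg_gen L).
Local Notation G := (cubeAut (davis L)).
Implicit Types (x y z : L) (s : seq L) (v w : W) (f g h : G).

Definition act f (w : W) : W := aut_fun f w.

Lemma act1 w : act 1 w = w.
Proof. by []. Qed.

Lemma actM f g w : act (f * g) w = act f (act g w).
Proof. by []. Qed.

Lemma actK f : cancel (act f) (act f^-1).
Proof. by move=> w; exact: (aut_funK f w). Qed.

Lemma actKV f : cancel (act f^-1) (act f).
Proof. by move=> w; exact: (aut_invK f w). Qed.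

Lemma act_inj f : injective (act f).
Proof. exact: can_inj (actK f). Qed.

Lemma aut_ext f g : act f =1 act g -> f = g.
Proof. by move=> fg; apply: cubeAut_eq => w; exact: (fg w). Qed.

Definition cayley_hom (F : W -> W) : Prop :=
  forall w x, exists y, F (w * gen x) = F w * gen y.

Lemma act_cayley f : cayley_hom (act f).
Proof.
move=> w x.
pose phi (a : cubeVertex 1) : davis L := if a ord0 then w * gen x else w.
have phiP : is_cube phi.
  split=> [a b|a b ab].
    move=> e; apply/ffunP => i; rewrite (ord1 i); move: e; rewrite /phi.
    case: (a ord0); case: (b ord0) => //; [move=> e|move=> /esym e]; exfalso;
    by apply: (@gen_neq1 _ x); apply: (@mulgI _ w); rewrite mulg1.
  have : a ord0 != b ord0.
    apply/negP => /eqP e; move: ab; rewrite /cube_adj eq_card0 //.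
    by move=> i; rewrite inE (ord1 i) e eqxx.
  rewrite /phi; case: (a ord0); case: (b ord0) => // _; last by exists x.
  by exists x; rewrite mul_gen_genKr.
have [_ adj] := (aut_cube f phi).2 phiP.
have /adj : cube_adj [ffun _ : 'I_1 => false] [ffun _ => true].
  rewrite /cube_adj (_ : [set _ | _] = [set: 'I_1]) ?cardsT ?card_ord //.
  by apply/setP => i; rewrite !inE !ffunE.
by rewrite /phi /= !ffunE.
Qed.

(** The 1-skeleton determines the Davis complex, so a pair of mutually inverse
    graph morphisms is an automorphism of it. *)
Lemma cayley_aut (F F' : W -> W) : cancel F F' -> cancel F' F ->
  cayley_hom F -> cayley_hom F' -> exists f, act f =1 F.
Proof.
move=> FK F'K Fh F'h.
have hom (E : W -> W) : cayley_hom E -> forall u v : W, cayley_adj u v ->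
    cayley_adj (E u) (E v).
  by move=> Eh u v [x ->]; have [y ->] := Eh u x; exists y.
have cubes k (phi : cubeVertex k -> davis L) :
    is_cube (F \o phi : _ -> davis L) <-> is_cube phi.
  split=> -[inj adj]; split.
  - by move=> a b e; apply: inj; rewrite /= e.
  - move=> a b /adj/(hom _ F'h) /=.
    by rewrite !FK.
  - by move=> a b /= /(can_inj FK)/inj.
  by move=> a b /adj/(hom _ Fh).
by exists (@CubeAut (davis L) F F' FK F'K cubes).
Qed.

Definition local_fun f w x : L := projT1 (cid (act_cayley f w x)).

Lemma local_funP f w x : act f (w * gen x) = act f w * gen (local_fun f w x).
Proof. by rewrite /local_fun; case: cid. Qed.

Lemma local_fun_inj f w : injective (local_fun f w).
Proof.
move=> x y e; apply/(@gen_inj L)/(@mulgI _ w)/(@act_inj f).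
by rewrite !local_funP e.
Qed.

(** The permutation of the link of w induced by f, once the links of w and of
    its image are both identified with L through the labels of the edges. *)
Definition local f w : {perm L} := perm (@local_fun_inj f w).

Lemma act_gen f w x : act f (w * gen x) = act f w * gen (local f w x).
Proof. by rewrite permE local_funP. Qed.

Lemma local_uniq f w x y : act f (w * gen x) = act f w * gen y -> local f w x = y.
Proof. by rewrite act_gen => /mulgI/gen_inj. Qed.

Lemma localM f g w : local (f * g) w = local g w * local f (act g w).
Proof. by apply/permP => x; apply: local_uniq; rewrite permM !actM !act_gen. Qed.

Lemma local1 w : local 1 w = 1.
Proof. by apply/permP => x; apply: local_uniq; rewrite perm1. Qed.

Lemma localV f w : local f^-1 (act f w) = (local f w)^-1.
Proof. by apply/esym/mulg1_eq; rewrite -localM mulVg local1. Qed.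

Lemma local_same f w x : local f (w * gen x) x = local f w x.
Proof.
by apply: local_uniq; rewrite mul_gen_genKr act_gen mul_gen_genKr.
Qed.

(* The image of the square with sides x and y at w has equal labels on opposite
   sides, by the abelianisation; its labels commute, so they are adjacent. *)
Let local_square f w x y : adjacent x y ->
  adjacent (local f w x) (local f w y) /\ local f (w * gen x) y = local f w y.
Proof.
move=> xy; have nxy : x != y by case/andP: xy.
have : act f (w * gen x * gen y) = act f (w * gen y * gen x).
  by rewrite -!mulgA racg_genC.
rewrite !act_gen -!mulgA => /mulgI e; have := gen2_eq e.
case=> [[_ eyx]|[[/perm_inj exy]|[exy ey]]].
- have : act f (w * gen y * gen x) = act f w.
    by rewrite !act_gen eyx mul_gen_genKr.
  move/act_inj; rewrite -mulgA -{2}[w]mulg1 => /mulgI.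
  rewrite -(racg_genK y) => /mulgI/gen_inj exy.
  by rewrite exy eqxx in nxy.
- by rewrite exy eqxx in nxy.
split=> //; apply: gen_comm_adj; first by rewrite (inj_eq perm_inj).
by rewrite -{1}ey e -exy.
Qed.

Lemma local_adj f w x y :
  adjacent (local f w x) (local f w y) = adjacent x y.
Proof.
apply/idP/idP => [|/(local_square f w)[]//].
by move/(local_square f^-1 (act f w))=> []; rewrite localV !permK.
Qed.

Definition star x : {pred L} := [pred y | (y == x) || adjacent x y].

Lemma star_refl x : x \in star x.
Proof. by rewrite inE eqxx. Qed.

Lemma local_star f w x y : y \in star x -> local f (w * gen x) y = local f w y.
Proof.
by rewrite inE => /orP[/eqP->|/(local_square f w)[]//]; exact: local_same.
Qed.

Lemma act_eq_on f g w x :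
  act f w = act g w -> local f w = local g w ->
  act f (w * gen x) = act g (w * gen x).
Proof. by move=> e le; rewrite !act_gen e le. Qed.

Lemma aut_eq f g : act f 1 = act g 1 -> local f =1 local g -> f = g.
Proof.
move=> e1 el; apply: aut_ext; elim/racg_ind => // w x IH.
exact: act_eq_on.
Qed.

(** * Portraits *)

(** Exactly the families of local actions of the automorphisms, as shown by the
    next two lemmas; automorphisms can thus be prescribed vertex by vertex
    subject to a condition on each edge only. *)
Definition portrait (sg : W -> {perm L}) : Prop :=
  (forall w x y, adjacent (sg w x) (sg w y) = adjacent x y) /\
  (forall w x y, y \in star x -> sg (w * gen x) y = sg w y).

Lemma local_portrait f : portrait (local f).
Proof. by split=> [w x y|w x y]; [exact: local_adj|exact: local_star]. Qed.

Lemma portrait_aut sg : portrait sg ->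
  exists f, act f 1 = 1 /\ local f =1 sg.
Proof.
move=> [adj st].
pose stepf x (p : W * W) := (p.1 * gen x, p.2 * gen (sg p.1 x)).
have stepfP : racg_steps stepf.
  split=> [x [w v]|x y [w v] xy]; rewrite /stepf /=.
    by rewrite st ?star_refl // !mul_gen_genKr.
  have yx : adjacent y x by rewrite adjacent_sym.
  rewrite !st ?inE ?xy ?yx ?orbT //.
  by rewrite -!mulgA (racg_genC xy) (@racg_genC _ (sg w x)) ?adj.
pose stepg x (w : W) := w * gen ((sg w)^-1 x).
have stepgP : racg_steps stepg.
  split=> [x w|x y w xy]; rewrite /stepg.
    have -> : (sg (w * gen ((sg w)^-1 x)))^-1 x = (sg w)^-1 x.
      by apply: (canLR (permK _)); rewrite st ?star_refl // permKV.
    exact: mul_gen_genKr.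
  have aux (a b : L) : adjacent a b ->
      (sg (w * gen ((sg w)^-1 a)))^-1 b = (sg w)^-1 b.
    move=> ab; apply: (canLR (permK _)); rewrite st ?permKV //.
    by rewrite inE -(adj w) !permKV ab orbT.
  rewrite !aux // 1?adjacent_sym // -!mulgA racg_genC //.
  by rewrite -(adj w) !permKV.
pose F w := (run stepf (1, 1) w).2; pose F' w := run stepg 1 w.
have F1 : F 1 = 1 by rewrite /F run1.
have FM w x : F (w * gen x) = F w * gen (sg w x).
  rewrite /F run_gen //=; congr (_ * gen (sg _ x)).
  by elim/racg_ind: w => [|w y IH]; rewrite ?run1 // run_gen //= IH.
have F'1 : F' 1 = 1 by exact: run1.
have F'M w x : F' (w * gen x) = F' w * gen ((sg (F' w))^-1 x) by exact: run_gen.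
have FK : cancel F F'.
  by elim/racg_ind => [|w x IH]; rewrite ?F1 // FM F'M IH permK.
have F'K : cancel F' F.
  by elim/racg_ind => [|w x IH]; rewrite ?F'1 // F'M FM IH permKV.
have [||f fF] := cayley_aut FK F'K.
- by move=> w x; exists (sg w x); rewrite FM.
- by move=> w x; exists ((sg (F' w))^-1 x); rewrite F'M.
exists f; split; first by rewrite fF.
by move=> w; apply/permP => x; apply: local_uniq; rewrite !fF FM.
Qed.

End Automorphisms.


(** * Automorphisms supported in half-spaces *)

Section Supports.
Variable L : simplicialComplex.
Local Notation W := (racg L).
Local Notation gen := (@racg_gen L).
Local Notation G := (cubeAut (davis L)).
Implicit Types (x y z : L) (s : seq L) (v w : W) (f g h u : G).

Let lmul_ex (v : W) : exists f : G, act f =1 (fun w => v * w).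
Proof.
apply: (@cayley_aut _ _ (fun w => v^-1 * w)).
- exact: mulKg.
- exact: mulVKg.
- by move=> w x; exists x; rewrite mulgA.
- by move=> w x; exists x; rewrite mulgA.
Qed.

Definition lmul v : G := projT1 (cid (lmul_ex v)).

Lemma act_lmul v w : act (lmul v) w = v * w.
Proof. by rewrite /lmul; case: cid. Qed.

Lemma lmulM v w : lmul (v * w) = lmul v * lmul w.
Proof. by apply: aut_ext => t; rewrite actM !act_lmul mulgA. Qed.

Lemma lmul1 : lmul 1 = 1.
Proof. by apply: aut_ext => t; rewrite act_lmul mul1g. Qed.

Lemma lmulV v : lmul v^-1 = (lmul v)^-1.
Proof. by apply/esym/mulg1_eq; rewrite -lmulM mulgV lmul1. Qed.

Lemma local_lmul v w : local (lmul v) w = 1.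
Proof.
by apply/permP => x; apply: local_uniq; rewrite perm1 !act_lmul mulgA.
Qed.

(* An element that commutes with x is a word in the star of x, and f respects
   stars. *)
Let local_centralizer f x w : act f 1 = 1 -> gen x ^ w = gen x ->
  local f w x = local f 1 x
  /\ gen (local f 1 x) ^ act f w = gen (local f 1 x).
Proof.
move=> f1 c; have [s -> st] : exists2 s, w = word s & all [in star x] s.
  have cw : w * gen x = gen x * w by rewrite -{1}c conjgE mulVKg.
  case: (boolP (half x w)) => [xw|/negbTE xw].
    have [||s e sx] := @centralizer_word L x (w * gen x).
    - by rewrite {1}cw mulgA.
    - by rewrite half_gen xw c eqxx.
    exists (rcons s x); first by rewrite word_rcons -e mul_gen_genKr.
    rewrite all_rcons star_refl; apply: sub_all sx => y xy.
    by rewrite inE xy orbT.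
  have [s e sx] := centralizer_word cw xw; exists s => //.
  by apply: sub_all sx => y xy; rewrite inE xy orbT.
elim/last_ind: s st => [|s y IH] /=; first by rewrite f1 conjg1.
rewrite all_rcons => /andP[yx /IH[e1 e2]]; rewrite word_rcons.
have xy : x \in star y.
  by move: yx; rewrite !inE eq_sym => /orP[->//|]; rewrite adjacent_sym orbC => ->.
rewrite local_star // act_gen conjgM e2; split=> //.
move: yx; rewrite inE => /orP[/eqP->|adj].
  by rewrite e1 conjgE mulKg.
have := local_adj f (word s) x y; rewrite adj e1 => a.
by rewrite conjgE (racg_genC a) mulKg.
Qed.

Let half_act_edge f x w y : act f 1 = 1 -> gen x ^ w = gen y ->
  gen (local f 1 x) ^ act f w = gen (local f w y).
Proof.
move=> f1 e; have xy := conj_gen_eq e; rewrite -xy in e *.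
by have [-> ->] := local_centralizer f1 e.
Qed.

(** An edge crosses the wall of x when it is reached from the edge (1, x) by
    passing through squares, and the local actions transport its label along
    them. *)
Lemma half_act1 f x w : act f 1 = 1 -> half (local f 1 x) (act f w) = half x w.
Proof.
move=> f1; elim/racg_ind: w => [|w y IH]; first by rewrite f1 !half1.
rewrite act_gen !half_gen IH; congr (_ (+) _).
apply/eqP/eqP; last exact: half_act_edge.
have fV1 : act f^-1 1 = 1 by rewrite -{1}f1 actK.
move/(half_act_edge fV1); rewrite actK localV permK.
by rewrite -{1}f1 localV permK.
Qed.

(** A left translation brings f 1 back to 1. *)
Lemma half_act f x w :
  half (local f 1 x) ((act f 1)^-1 * act f w) = half x w.
Proof.
have f1 : act (lmul (act f 1)^-1 * f) 1 = 1 by rewrite actM act_lmul mulVg.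
by rewrite -(half_act1 x w f1) actM act_lmul localM local_lmul mulg1.
Qed.

Definition supported x u := forall w, half x w = false -> act u w = w.

Lemma supportedV x u : supported x u -> supported x u^-1.
Proof. by move=> ux w xw; rewrite -{1}(ux w xw) actK. Qed.

(** The complement of a half-space is connected: folding a path along the wall
    keeps it a path. So an automorphism is determined there by its local
    actions. *)
Lemma agree_off_half f g x : act f 1 = act g 1 ->
  (forall w, half x w = false -> local f w = local g w) ->
  forall w, half x w = false -> act f w = act g w.
Proof.
move=> e1 el; pose fold w := if half x w then gen x * w else w.
have off w : half x (fold w) = false.
  by rewrite /fold; case: ifP => [xw|//]; rewrite half_genl xw.
suff ef w : act f (fold w) = act g (fold w).
  by move=> w xw; have := ef w; rewrite /fold xw.
elim/racg_ind: w => [|w y IH]; first by rewrite /fold half1.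
case: (eqVneq (half x (w * gen y)) (half x w)) => [e|/[dup] ne /half_edge[<- c]].
  have -> : fold (w * gen y) = fold w * gen y.
    by rewrite /fold e; case: ifP; rewrite ?mulgA.
  by apply: act_eq_on => //; exact: el.
suff -> : fold (w * gen x) = fold w by [].
have [exy _] := half_edge ne; rewrite -exy in ne.
rewrite /fold; case: (half x w) ne; case: (half x _) => // _.
by rewrite c mul_gen_genK.
Qed.

(** The simple subgroup. Conjugating by arbitrary automorphisms makes it normal
    by construction and accounts for all half-spaces, not only those bounded by
    walls through an edge at 1. *)
Inductive half_generated : G -> Prop :=
| half_generated1 : half_generated 1
| half_generatedS f x u g : supported x u -> half_generated g ->
    half_generated (f * u * f^-1 * g).

Local Notation H := half_generated.

Lemma supported_conj_generated f x u : supported x u -> H (f * u * f^-1).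
Proof.
by move=> ux; rewrite -[_ / f]mulg1; apply: half_generatedS ux _; constructor.
Qed.

Lemma supported_generated x u : supported x u -> H u.
Proof. by move=> /(supported_conj_generated 1); rewrite invg1 mulg1 mul1g. Qed.

Lemma half_generatedM f g : H f -> H g -> H (f * g).
Proof.
move=> Hf Hg; elim: Hf => [|{}f x u k ux _ IH]; first by rewrite mul1g.
by rewrite -[_ * k * g]mulgA; exact: half_generatedS ux IH.
Qed.

Lemma half_generatedV f : H f -> H f^-1.
Proof.
elim=> [|{}f x u k /supportedV ux _ IH]; first by rewrite invg1; constructor.
rewrite invgM; apply: half_generatedM IH _; rewrite !invgM invgK mulgA.
exact: supported_conj_generated ux.
Qed.

Lemma half_generatedJ f g : H g -> H (f * g * f^-1).
Proof.
elim=> [|k x u {}g ux _ IH]; first by rewrite mulg1 mulgV; constructor.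
have -> : f * (k * u * k^-1 * g) * f^-1
    = f * k * u * (f * k)^-1 * (f * g * f^-1).
  by rewrite invgM !mulgA mulgVK.
exact: half_generatedS ux IH.
Qed.

(** * Small automorphisms are generated by supported ones *)

(** The maps along which portraits can be pulled back. *)
Definition collapse (q : W -> W) := forall w x,
  q (w * gen x) = q w \/ q (w * gen x) = q w * gen x.

Lemma portrait_collapse (sg : W -> {perm L}) q : portrait sg -> collapse q ->
  portrait (sg \o q).
Proof.
move=> [adj st] cq; split=> [w x y|w x y yx] /=; first exact: adj.
by case: (cq w x) => ->; rewrite ?st.
Qed.

(** Pushes the half-space of x into the wall by means of the retraction. It
    replaces the nearest-point projection to the complement, with which it
    agrees next to the wall. *)
Definition cut x w := if half x w then retr (adjacent x) w else w.

Let notin_link x : (x \in adjacent x) = false.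
Proof. exact: adjacent_irr. Qed.

Lemma cut_collapse x : collapse (cut x).
Proof.
move=> w y; rewrite /cut.
case: (eqVneq (half x (w * gen y)) (half x w)) => [->|ne].
  by case: ifP; [rewrite retr_gen; case: ifP; [right|left]|right].
have [<- c] := half_edge ne; have [exy _] := half_edge ne.
rewrite -exy in ne; left.
have rg : retr (adjacent x) (w * gen x) = retr (adjacent x) w.
  by rewrite retr_gen notin_link.
case: (boolP (half x w)) ne => xw; case: (boolP (half x _)) => // wx _.
  rewrite -rg retr_centralizer ?(negbTE wx) //.
  by rewrite {1}c mulgA.
by rewrite rg retr_centralizer // (negbTE xw).
Qed.

Lemma half_word_mem x s : half x (word s) -> x \in s.
Proof.
elim/last_ind: s => [|s y IH]; first by rewrite half1.
rewrite word_rcons half_gen mem_rcons inE.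
case: (boolP (half x _)) => [/IH-> _|_ /eqP/conj_gen_eq->]; first exact: orbT.
by rewrite eqxx.
Qed.

(* The measure that decreases whenever a cut moves an element. *)
Let few k w := exists2 s, w = word s & size (undup s) <= k.

Let few_cut k x w : few k w -> few k (cut x w).
Proof.
rewrite /cut; case: ifP => // _ [s -> sk]; rewrite retr_word.
exists [seq y <- s | y \in adjacent x] => //.
by rewrite -filter_undup size_filter (leq_trans (count_size _ _)).
Qed.

Let few_cut_lt k x w : half x w -> few k.+1 w -> few k (cut x w).
Proof.
rewrite /cut => xw; rewrite xw => -[s e sk]; rewrite e retr_word.
exists [seq y <- s | y \in adjacent x] => //.
rewrite -ltnS -filter_undup size_filter (leq_trans _ sk) //.
rewrite -(count_predC [in adjacent x] (undup s)) -[X in X < _]addn0 ltn_add2l.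
rewrite -has_count; apply/hasP; exists x.
  by rewrite mem_undup half_word_mem // -e.
by rewrite /= notin_link.
Qed.

Let few_cuts k l w : few k w -> few k (foldl (fun w x => cut x w) w l).
Proof. by elim: l w => //= x l IH w /(few_cut x)/IH. Qed.

Let few_pass k w : few k.+1 w ->
  few k (foldl (fun w x => cut x w) w (enum L)).
Proof.
move=> kw; have [->|/eqP/half_neq1[x]] := eqVneq w 1.
  by apply: few_cuts; exists [::].
have : x \in enum L by rewrite mem_enum.
elim: (enum L) w kw => //= y l IH w kw; rewrite inE.
case: (boolP (half y w)) => [yw _ _|yw].
  by apply: few_cuts; exact: few_cut_lt.
have -> : cut y w = w by rewrite /cut (negbTE yw).
move=> /orP[/eqP->|]; first by rewrite (negbTE yw).
exact: IH.
Qed.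

Let cuts_trivial k w : few k w ->
  foldl (fun w x => cut x w) w (flatten (nseq k (enum L))) = 1.
Proof.
elim: k w => [|k IH] w kw /=; last by rewrite foldl_cat IH //; exact: few_pass.
by case: kw => s ->; rewrite leqn0 size_eq0 => /eqP/undup_nil->.
Qed.

Let cuts_generated f l : act f 1 = 1 -> exists g,
  [/\ act g 1 = 1, H (g^-1 * f)
    & forall w, local g w = local f (foldl (fun w x => cut x w) w l)].
Proof.
move=> f1; elim: l => [|x l [g [g1 Hg gf]]].
  by exists f; split=> //; rewrite mulVg; constructor.
have [k [k1 kl]] := portrait_aut
  (portrait_collapse (local_portrait g) (cut_collapse x)).
exists k; split=> [//||w]; last by rewrite kl /= gf.
have -> : k^-1 * f = k^-1 * g * (g^-1 * f) by rewrite mulgA mulgK.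
apply: half_generatedM Hg; apply: (@supported_generated x) => w xw.
rewrite actM -(@agree_off_half k g x) ?k1 ?g1 ?actK //.
by move=> v xv; rewrite kl /= /cut xv.
Qed.

(** Precomposing a portrait with cut x changes it only in a half-space. As
    sufficiently many cuts map everything to 1, an automorphism that fixes the
    star of 1 is a finite product of automorphisms supported in half-spaces. *)
Lemma local1_generated f : act f 1 = 1 -> local f 1 = 1 -> H f.
Proof.
move=> f1 fl.
have [g [g1 Hg gl]] := cuts_generated (flatten (nseq #|L| (enum L))) f1.
suff g_1 : g = 1 by move: Hg; rewrite g_1 invg1 mul1g.
apply: aut_eq => // w; rewrite gl cuts_trivial ?fl ?local1 //.
have [s ->] := wordP w; exists s => //.
by rewrite cardE uniq_leq_size ?undup_uniq // => x; rewrite mem_enum.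
Qed.

End Supports.


Definition star_fixing (L : simplicialComplex) (x : L) (p : {perm L}) : Prop :=
  (forall y z, adjacent (p y) (p z) = adjacent y z) /\
  {in star x, forall y, p y = y}.

(** What the proof of virtual simplicity needs of the 1-skeleton. Transitivity
    makes the translations by words of even length half-generated; non-rigid
    stars provide automorphisms that twist a half-space; independent triples
    provide nested chains of half-spaces of lengths of both parities; and an
    automorphism moving a vertex x to an adjacent y is handled with a vertex
    independent of both. *)
Record star_flexible (L : simplicialComplex) : Prop := StarFlexible {
  star_transitive : forall P : L -> Prop,
    (forall x p, star_fixing x p -> forall y, P y -> P (p y)) ->
    forall y z, P y -> P z;
  star_nonrigid : forall x : L, exists2 p, star_fixing x p & p != 1;
  indep_triple : forall x : L, exists y z, [/\ indep x y, indep y z & indep x z];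
  adjacent_indep : forall x y : L, adjacent x y ->
    exists2 z, indep x z & indep y z
}.

Section Flexible.
Variable L : simplicialComplex.
Hypothesis flexL : star_flexible L.
Local Notation W := (racg L).
Local Notation gen := (@racg_gen L).
Local Notation G := (cubeAut (davis L)).
Local Notation H := (@half_generated L).
Implicit Types (x y z : L) (s : seq L) (v w : W) (f g h u : G) (p : {perm L}).

(** * The generated subgroup has finite index *)

(** Crossing an edge into the half-space changes the portrait by p only at the
    wall of x, where p is invisible on the star of x. *)
Lemma twist_ex x p : star_fixing x p -> exists u, [/\ supported x u,
  act u 1 = 1 & forall w, local u w = if half x w then p else 1].
Proof.
move=> [adj st]; have [|u [u1 ul]] :=
    @portrait_aut L (fun w => if half x w then p else 1).
  split=> [w y z|w y z zy]; first by case: ifP; rewrite ?perm1.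
  case: (eqVneq (half x (w * gen y)) (half x w)) => [-> //|/half_edge[xy _]].
  by case: ifP; case: ifP; rewrite ?perm1 // st // xy.
exists u; split=> // w xw; apply: (@agree_off_half _ u 1 x) => // v xv.
by rewrite ul xv local1.
Qed.

Lemma diagonal_ex p : (forall y z, adjacent (p y) (p z) = adjacent y z) ->
  exists f, act f 1 = 1 /\ forall w, local f w = p.
Proof. by move=> adj; apply: (@portrait_aut L (fun _ => p)). Qed.

Lemma diagonalM p f v w : act f 1 = 1 -> (forall w, local f w = p) ->
  act f (v * w) = act f v * act f w.
Proof.
move=> f1 fl; elim/racg_ind: w => [|w x IH]; first by rewrite f1 !mulg1.
by rewrite !mulgA !act_gen IH !fl mulgA.
Qed.

(* The twists in the two half-spaces bounded by the wall of x combine to the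
   automorphism of W that permutes the generators by p. *)
Lemma diagonal_generated x p f : star_fixing x p -> act f 1 = 1 ->
  (forall w, local f w = p) -> H f.
Proof.
move=> px f1 fl; have [e [ex e1 el]] := twist_ex px.
have -> : f = e * (lmul (gen x) * ((lmul (gen x))^-1 * (e^-1 * f) * lmul (gen x))
    * (lmul (gen x))^-1).
  by rewrite !mulgA !mulgK mulgV mul1g.
apply: half_generatedM (supported_generated ex) (half_generatedJ _ _).
apply: (@supported_generated _ x) => w xw.
have xp : p x = x by case: px => _ ->; rewrite ?star_refl.
suff e_f : act (f * lmul (gen x)) w = act (e * lmul (gen x)) w.
  by rewrite !actM in e_f *; rewrite e_f !actK.
apply: agree_off_half xw => [|v xv].
  rewrite !actM !act_lmul !mulg1 -[gen x]mul1g !act_gen f1 e1 fl el half1.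
  by rewrite xp perm1.
by rewrite !localM !local_lmul !mul1g fl el act_lmul half_genl xv.
Qed.

Lemma diagonal_lmul p f v : act f 1 = 1 -> (forall w, local f w = p) ->
  f * lmul v * f^-1 = lmul (act f v).
Proof.
move=> f1 fl; apply: aut_ext => w; rewrite !actM !act_lmul.
by rewrite (diagonalM _ _ f1 fl) actKV.
Qed.

(** The diagonal automorphism f of p lies in the subgroup, hence so does its
    commutator with the translation by y, which is the translation by
    y * p y. *)
Lemma even_generated x y : H (lmul (gen x * gen y)).
Proof.
move: y; suff : forall z, H (lmul (gen x * gen x)) -> H (lmul (gen x * gen z)).
  by move=> Hx y; apply: Hx; rewrite racg_genK lmul1; constructor.
move=> z; apply: (star_transitive flexL (P := fun y => H (lmul (gen x * gen y)))).
move=> {}z p pz y Hy; have [f [f1 fl]] := diagonal_ex (proj1 pz).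
  have Hf := diagonal_generated pz f1 fl.
  have -> : gen x * gen (p y) = gen x * gen y * (gen y * gen (p y)).
    by rewrite mulgA mul_gen_genKr.
  rewrite lmulM; apply: half_generatedM Hy _.
  have -> : lmul (gen y * gen (p y)) = lmul (gen y) * f * (lmul (gen y))^-1 * f^-1.
    rewrite -!mulgA -lmulV racg_genV [f * (_ * _)]mulgA (diagonal_lmul _ f1 fl).
    have -> : act f (gen y) = gen (p y) by rewrite -[gen y]mul1g act_gen f1 fl mul1g.
    by rewrite lmulM.
exact: half_generatedM (half_generatedJ _ Hf) (half_generatedV Hf).
Qed.

Lemma lmul_generated w x : H (lmul w) \/ H (lmul (w * gen x)).
Proof.
elim/racg_ind: w => [|w y [IH|IH]]; first by left; rewrite lmul1; constructor.
  by right; rewrite -mulgA lmulM; exact/half_generatedM/even_generated.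
left; have -> : w * gen y = w * gen x * (gen x * gen y).
  by rewrite mulgA mul_gen_genKr.
by rewrite lmulM; exact/half_generatedM/even_generated.
Qed.

Definition half_pred : {pred G} := fun f => `[< H f >].

Lemma half_predP f : reflect (H f) (f \in half_pred).
Proof. exact: asboolP. Qed.

(** An automorphism is determined up to the subgroup by the parity of the
    image of 1 and by its local action at 1. *)
Lemma half_finite_index (x0 : L) : finite_index half_pred.
Proof.
have rep_ex p : exists r : G, (exists2 f, act f 1 = 1 & local f 1 = p) ->
    act r 1 = 1 /\ local r 1 = p.
  have [[f f1 fp]|none] := pselect (exists2 f, act f 1 = 1 & local f 1 = p).
    by exists f.
  by exists 1.
pose rep p := projT1 (cid (rep_ex p)).
have repP f : act f 1 = 1 ->
    act (rep (local f 1)) 1 = 1 /\ local (rep (local f 1)) 1 = local f 1.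
  by move=> f1; rewrite /rep; case: cid => r /= rP; apply: rP; exists f.
exists ([seq rep p | p <- enum {: {perm L}}]
  ++ [seq lmul (gen x0) * rep p | p <- enum {: {perm L}}]) => g.
set v := act g 1; pose g1 := lmul v^-1 * g.
have g11 : act g1 1 = 1 by rewrite /g1 actM act_lmul mulVg.
have [r1 rl] := repP _ g11; set r := rep _ in r1 rl.
have Hr : H (r^-1 * g1).
  apply: local1_generated; first by rewrite actM g11 -{1}r1 actK.
  by rewrite localM g11 -{2}r1 localV rl mulgV.
have eg : g = lmul v * g1 by rewrite /g1 lmulV mulVKg.
have rm : r \in [seq rep p | p <- enum {: {perm L}}].
  by apply: map_f; rewrite mem_enum.
have [Hv|Hv] := lmul_generated v x0.
  exists r; first by rewrite mem_cat rm.
  apply/half_predP; have -> : r^-1 * g = r^-1 * lmul v * r^-1^-1 * (r^-1 * g1).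
    by rewrite invgK [in LHS]eg !mulgA mulgK.
  exact: half_generatedM (half_generatedJ _ Hv) Hr.
exists (lmul (gen x0) * r).
  by rewrite mem_cat; apply/orP; right; apply: map_f; rewrite mem_enum.
apply/half_predP.
have -> : (lmul (gen x0) * r)^-1 * g
    = r^-1 * (lmul (gen x0) * lmul (v * gen x0) * (lmul (gen x0))^-1) * r^-1^-1
      * (r^-1 * g1).
  rewrite invgK invgM -lmulV racg_genV -!lmulM !mulgA mulgK mul_gen_genKr.
  by rewrite [in LHS]eg lmulM !mulgA.
exact: half_generatedM (half_generatedJ _ (half_generatedJ _ Hv)) Hr.
Qed.

(** * Normal subgroups contain an element displacing a half-space *)

Definition displaces f g x :=
  forall w, half x w -> half x (act (f^-1 * g * f) w) = false.

(** Next to a fixed vertex u whose link is moved, g sends the half-space of some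
    edge (u, x) to that of (u, y) with y different from x. They are disjoint if
    x and y are not adjacent; otherwise a smaller half-space, beyond u * x, is
    displaced. *)
Lemma displace_fixed g v : act g v = v -> g != 1 -> exists f x, displaces f g x.
Proof.
move=> gv g1.
have [u gu /eqP lu] : exists2 u, act g u = u & local g u <> 1.
  have [//|none] := pselect (exists2 u, act g u = u & local g u <> 1).
  case/eqP: g1; apply: aut_ext => w; rewrite act1 -(mulVKg v w).
  elim/racg_ind: (v^-1 * w) => [|t x IH]; first by rewrite mulg1.
  rewrite mulgA act_gen IH; congr (_ * gen _).
  have [->|/eqP lt] := eqVneq (local g (v * t)) 1; first by rewrite perm1.
  by case: none; exists (v * t).
have [x px] : exists x, local g u x != x.
  apply/existsP; apply: contraNT lu => /existsPn lx.
  by apply/eqP/permP => x; rewrite perm1; have := lx x; rewrite negbK => /eqP.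
pose k := (lmul u)^-1 * g * lmul u.
have k1 : act k 1 = 1.
  by rewrite /k !actM act_lmul mulg1 gu -lmulV act_lmul mulVg.
have kl : local k 1 = local g u.
  rewrite /k !localM local_lmul !act_lmul mulg1 mul1g gu.
  by rewrite -lmulV local_lmul mulg1.
set y := local g u x in px.
have xy w : half x w -> half y (act k w).
  by rewrite -(half_act1 x w k1) kl.
have [ind|nind] := boolP (indep y x).
  by exists (lmul u), x => w /xy/(half_indep ind).
have adj : adjacent x y.
  by move: nind; rewrite /indep px adjacent_sym negbK.
have [z xz yz] := adjacent_indep flexL adj.
exists (lmul u * lmul (gen x)), z => w zw.
rewrite (_ : _ * g * _ = lmul (gen x) * k * lmul (gen x)); last first.
  by rewrite /k invgM -!lmulV racg_genV !mulgA.
rewrite 2!actM !act_lmul; apply: (half_indep yz).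
by rewrite half_adjl //; apply: xy; exact: half_nest xz zw.
Qed.

Definition normal_pred (N : G -> Prop) : Prop :=
  [/\ N 1, forall f g, N f -> N g -> N (f * g), forall f, N f -> N f^-1
    & forall h f, H h -> N f -> N (h * f * h^-1)].

Lemma normal_pred_conj (N : G -> Prop) f : normal_pred N ->
  normal_pred (fun g => N (f * g * f^-1)).
Proof.
move=> [N1 NM NV NJ]; split=> [|g h gN hN|g gN|h g Hh gN].
- by rewrite mulg1 mulgV.
- rewrite (_ : _ * f^-1 = f * g * f^-1 * (f * h * f^-1)); first exact: NM.
  by rewrite !mulgA mulgVK.
- rewrite (_ : _ * f^-1 = (f * g * f^-1)^-1); first exact: NV.
  by rewrite !invgM invgK mulgA.
rewrite (_ : _ * f^-1 = f * h * f^-1 * (f * g * f^-1) * (f * h * f^-1)^-1).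
  exact/NJ/gN/half_generatedJ.
by rewrite !invgM invgK !mulgA !mulgVK.
Qed.

(** Choose a half-space D containing the image of a moved vertex v but not v.
    Either g displaces the complement of D, or some vertex and its image both
    lie off D. The commutator of g with a twist supported in D then fixes that
    image, so the previous lemma applies to it; it is non-trivial since g
    carries v, whose link the twist fixes, into D, where all links are twisted. *)
Lemma displace_ex (N : G -> Prop) g : normal_pred N -> N g -> g != 1 ->
  exists h f x, N h /\ displaces f h x.
Proof.
move=> [_ NM NV NJ] Ng g1.
have [v gv] : exists v, act g v <> v.
  apply: contrapT => none; case/eqP: g1; apply: aut_ext => w.
  by rewrite act1; apply: contrapT => gw; apply: none; exists w.
pose k := (lmul v)^-1 * g * lmul v.
have kv : act k 1 <> 1.
  rewrite /k !actM act_lmul mulg1 -lmulV act_lmul => /mulg1_eq.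
  by rewrite invgK => /esym.
have [x xk] := half_neq1 kv.
have [[w [xw xkw]]|none] :=
    pselect (exists w, half x w = false /\ half x (act k w) = false); last first.
  exists g, (lmul v * lmul (gen x)), x; split=> // w xw.
  rewrite (_ : _ * g * _ = lmul (gen x) * k * lmul (gen x)); last first.
    by rewrite /k invgM -!lmulV racg_genV !mulgA.
  rewrite 2!actM !act_lmul half_genl; apply/negbTE; rewrite negbK.
  apply: contrapT => /negP/negbTE xkw; apply: none.
  by exists (gen x * w); rewrite half_genl xw.
have [p px p1] := star_nonrigid flexL x.
have [e [ex e1 el]] := twist_ex px.
pose E := lmul v * e * (lmul v)^-1.
have HE : H E by exact: supported_conj_generated ex.
pose c := k * e * k^-1 * e^-1.
have ec : g * (E * g^-1 * E^-1) = lmul v * c * (lmul v)^-1.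
  by rewrite /E /c /k !invgM !invgK !mulgA mulgV mul1g.
have Nc : N (g * (E * g^-1 * E^-1)) by apply/NM/NJ/NV.
have [||f [y fy]] := @displace_fixed (g * (E * g^-1 * E^-1)) (v * act k w).
- rewrite ec 2!actM -lmulV !act_lmul mulKg; congr (_ * _); rewrite /c 3!actM.
  have -> : act e^-1 (act k w) = act k w by apply: supportedV ex _ _.
  by rewrite actK ex.
- apply: contra_neqN p1; rewrite ec => /eqP c1.
  have {}c1 : c = 1.
    have := congr1 (fun f => (lmul v)^-1 * f * lmul v) c1.
    by rewrite mulg1 mulVg !mulgA mulVg mul1g mulgVK.
  have ke : k * e = e * k.
    by apply: divg1_eq; rewrite invgM mulgA.
  have := congr1 (fun f => local f 1) ke; rewrite !localM e1 !el half1 xk mul1g.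
  by rewrite -[X in X = _]mulg1 => /mulgI.
by exists (g * (E * g^-1 * E^-1)), f, y.
Qed.

End Flexible.


(** * Commutators of infinite products *)

Section Patch.
Variable L : simplicialComplex.
Local Notation W := (racg L).
Local Notation gen := (@racg_gen L).
Local Notation G := (cubeAut (davis L)).
Implicit Types (v w : W) (t u : G).
Variables (D : nat -> W -> Prop).
Hypothesis disjD : forall i j w, D i w -> D j w -> i = j.

Let fixes_off (un : nat -> G) := forall i w, ~ D i w -> act (un i) w = w.

Let glue (un : nat -> G) w : W :=
  if pselect (exists i, D i w) is left e then act (un (projT1 (cid e))) w else w.

Let glue_in un i w : D i w -> glue un w = act (un i) w.
Proof.
rewrite /glue => iw; case: pselect => [e|[]]; last by exists i.
by case: cid => j jw; rewrite (disjD iw jw).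
Qed.

Let glue_out un w : (forall i, ~ D i w) -> glue un w = w.
Proof.
rewrite /glue => out; case: pselect => // e; case: (e) => i iw.
by case: (out i).
Qed.

Let stable un i w : fixes_off un -> D i w -> D i (act (un i) w).
Proof.
move=> off iw; apply: contrapT => niw; have /act_inj e := off _ _ niw.
by rewrite e in niw.
Qed.

Let cases w : (exists i, D i w) \/ (forall i, ~ D i w).
Proof.
have [|none] := pselect (exists i, D i w); first by left.
by right=> i iw; apply: none; exists i.
Qed.

(* At most two of the factors matter for an edge, so there the glued map agrees
   with one of the automorphisms un i * un j, un i and 1. *)
Let glue_hom un : fixes_off un -> cayley_hom (glue un).
Proof.
move=> off w x; suff [g [-> ->]] : exists g : G,
    glue un w = act g w /\ glue un (w * gen x) = act g (w * gen x).
  exact: act_cayley.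
set v := w * gen x.
have [[i iw]|ow] := cases w; have [[j jv]|ov] := cases v.
- rewrite (glue_in un iw) (glue_in un jv).
  have [eij|/eqP nij] := eqVneq i j; first by exists (un j); rewrite eij.
  exists (un i * un j); rewrite !actM; split.
    by rewrite (off j) // => jw; apply: nij; exact: disjD iw jw.
  rewrite [RHS]off // => iv; apply: nij; apply: disjD iv _.
  exact: stable jv.
- by exists (un i); rewrite (glue_in un iw) (glue_out un ov) (off _ _ (ov i)).
- by exists (un j); rewrite (glue_in un jv) (glue_out un ow) (off _ _ (ow j)).
by exists 1; rewrite !glue_out.
Qed.

Let glueK un vn : fixes_off un -> (forall i, cancel (act (un i)) (act (vn i))) ->
  cancel (glue un) (glue vn).
Proof.
move=> off uvK w; have [[i iw]|ow] := cases w; last by rewrite !glue_out.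
by rewrite (glue_in un iw) (glue_in vn (stable off iw)) uvK.
Qed.

(** The family may be infinite and its supports may accumulate: being an
    automorphism is a condition on single edges. *)
Lemma patch (un : nat -> G) : fixes_off un -> exists u : G,
  (forall i w, D i w -> act u w = act (un i) w) /\
  (forall w, (forall i, ~ D i w) -> act u w = w).
Proof.
move=> off; have offV : fixes_off (fun i => (un i)^-1).
  by move=> i w /off e; rewrite -{1}e actK.
have [||||u e] := @cayley_aut _ (glue un) (glue (fun i => (un i)^-1)).
- by apply: glueK off _ => i; exact: actK.
- by apply: glueK offV _ => i; exact: actKV.
- exact: glue_hom.
- exact: glue_hom.
exists u; split=> [i w iw|w ow]; rewrite e.
  exact: glue_in.
exact: glue_out.
Qed.

End Patch.

(** Tits's commutator trick: if t maps E into itself and u is supported in a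
    part D of E that t E avoids, the supports of the conjugates of u by the
    powers of t are disjoint, and the product u' of all these conjugates
    satisfies u = [u', t]. *)
Lemma tits_commutator (L : simplicialComplex) (t u : cubeAut (davis L))
    (D E : racg L -> Prop) :
  (forall w, E w -> E (act t w)) ->
  (forall w, D w -> E w /\ ~ E (act t^-1 w)) ->
  (forall w, ~ D w -> act u w = w) ->
  exists2 u', forall w, ~ E w -> act u' w = w & u = u' * t * u'^-1 * t^-1.
Proof.
move=> tE DE Du; pose Dn i w := D (act (t ^- i) w).
have iE i w : E w -> E (act (t ^+ i) w).
  by elim: i => [|i IH] // Ew; rewrite expgS actM; exact/tE/IH.
have disj i j w : Dn i w -> Dn j w -> i = j.
  wlog ij : i j / i <= j => [wl|] iw jw.
    by have [/wl->//|/ltnW/wl->] := leqP i j.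
  apply/eqP; rewrite eqn_leq ij leqNgt; apply/negP => lij.
  have [_] := DE _ iw; apply; have [Ej _] := DE _ jw.
  have -> : act t^-1 (act (t ^- i) w) = act (t ^+ (j - i).-1) (act (t ^- j) w).
    rewrite -!actM; congr (act _ _).
    rewrite -invgM -expgSr; apply: (@mulIg _ (t ^+ j)); rewrite mulgVK.
    have ej : j = (i.+1 + (j - i).-1)%N by lia.
    by rewrite {1}ej expgnDr mulKg.
  exact: iE.
have [|u' [u'in u'out]] := @patch L Dn disj (fun i => t ^+ i * u * t ^- i).
  by move=> i w /Du e; rewrite !actM e -actM mulgV.
exists u' => [w nE|].
  apply: u'out => i iw; apply: nE; have [/(iE i)] := DE _ iw.
  by rewrite -actM mulgV.
suff c : u' * t = u * t * u' by rewrite c !mulgK.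
have shift i w : Dn i.+1 (act t w) = Dn i w.
  by rewrite /Dn expgS invgM actM actK.
apply: aut_ext => w; rewrite [LHS]actM !actM.
have [Dtw|nDtw] := pselect (Dn 0%N (act t w)).
  rewrite (u'in _ _ Dtw) u'out => [|i]; last first.
    by rewrite -shift => /(disj _ _ _ Dtw).
  by rewrite expg0 invg1 mulg1 mul1g.
have [[i iw]|none] := pselect (exists i, Dn i w).
  have := iw; rewrite -shift => siw; rewrite (u'in _ _ siw) (u'in _ _ iw); cbv beta.
  have e : act (t ^+ i.+1 * u * t ^- i.+1) (act t w)
      = act t (act (t ^+ i * u * t ^- i) w).
    by rewrite expgS invgM !actM actK.
  rewrite e Du // -e => D0.
  have s : Dn i.+1 (act (t ^+ i.+1 * u * t ^- i.+1) (act t w)).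
    apply: contrapT => ns; have := Du _ ns; rewrite /Dn in siw ns.
    move: ns; rewrite -actM !mulgA mulVg mul1g actM => ns.
    by move=> /act_inj ee; apply: ns; rewrite ee.
  have D00 : Dn 0%N (act (t ^+ i.+1 * u * t ^- i.+1) (act t w)).
    by rewrite /Dn expg0 invg1 act1.
  by have := disj _ _ _ D00 s.
have ow i : ~ Dn i w by move=> iw; apply: none; exists i.
rewrite (u'out _ ow) Du; last by move: nDtw; rewrite /Dn expg0 invg1.
by apply: u'out => -[|i]; [|rewrite shift].
Qed.


(** * Simplicity *)

Section Simplicity.
Variable L : simplicialComplex.
Hypothesis flexL : star_flexible L.
Local Notation W := (racg L).
Local Notation gen := (@racg_gen L).
Local Notation G := (cubeAut (davis L)).
Local Notation H := (@half_generated L).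
Implicit Types (x y z : L) (v w : W) (f g h u : G) (p : {perm L}).

(* Put a = x y z x for an independent triple. The half-space of x and its
   translate by a cover W, so the product t of k and of its conjugate by a maps
   the complement E of the translate into itself, and misses a half-space D
   of E. *)
Let displaced1 (N : G -> Prop) k x : normal_pred N -> N k ->
  (forall w, half x w -> half x (act k w) = false) ->
  exists f y, forall u, supported y u -> N (f * u * f^-1).
Proof.
move=> [_ NM NV NJ] Nk kx; have [y [z [xy yz xz]]] := indep_triple flexL x.
have zx : indep z x by rewrite indep_sym.
pose a := gen x * gen y * (gen z * gen x).
have aV : a^-1 = gen x * gen z * gen y * gen x.
  by rewrite /a !invgM !racg_genV !mulgA.
have Ha : H (lmul a) by rewrite lmulM; apply: half_generatedM; exact: even_generated.
pose b := lmul a * k * (lmul a)^-1; have Nb : N b by exact: NJ.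
pose E w := half x (a^-1 * w) = false.
have Ey w : E w -> half y (gen x * w).
  rewrite /E aV -!mulgA half_genl => /negbFE/(half_nest zx).
  by rewrite mul_gen_genK => /(half_nest yz); rewrite mul_gen_genK.
have Ex w : E w -> half x w.
  by move=> /Ey/(half_nest xy); rewrite mul_gen_genK.
have bE w : ~ E w -> E (act b w).
  move=> /eqP; rewrite eqbF_neg negbK => /kx.
  by rewrite /E /b 2!actM -lmulV !act_lmul mulKg.
pose t := b * k; have Nt : N t by exact: NM.
pose D w := half z (gen x * act b^-1 w).
have Dx w : D w -> half x (act b^-1 w).
  by move=> /(half_nest xz); rewrite mul_gen_genK.
have DE w : D w -> E w /\ ~ E (act t^-1 w).
  move=> Dw; split.
    rewrite -(actKV b w); apply: bE => /Ey/(half_indep yz).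
    by rewrite (_ : half z _) //.
  rewrite /t invgM actM => /Ex/kx; rewrite actKV.
  by rewrite (Dx _ Dw).
have tE w : E w -> E (act t w).
  move=> /Ex/kx kw; rewrite /t actM; apply: bE => /Ex.
  by rewrite kw.
exists (b * lmul (gen x)), z => u uz; set u0 := _ * u * _.
have Du w : ~ D w -> act u0 w = w.
  move=> /negP/negbTE nDw.
  have bw : act (b * lmul (gen x))^-1 w = gen x * act b^-1 w.
    by rewrite invgM actM -lmulV racg_genV act_lmul.
  by rewrite /u0 2!actM bw uz // actM act_lmul mul_gen_genK actKV.
have [u' u'E ->] := tits_commutator tE DE Du.
have Hu' : H u'.
  pose c := lmul (a * gen x).
  have -> : u' = c * (c^-1 * u' * c) * c^-1 by rewrite !mulgA mulgV mul1g mulgK.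
  apply: (@supported_conj_generated _ c x) => w xw; rewrite 2!actM u'E ?actK //.
  by rewrite /c act_lmul /E -mulgA mulKg half_genl xw.
by apply: NM (NV _ Nt); exact: NJ.
Qed.

Let displaced (N : G -> Prop) g f x : normal_pred N -> N g -> displaces f g x ->
  exists h y, forall u, supported y u -> N (h * u * h^-1).
Proof.
move=> NN Ng gx.
have [|h [y hN]] := displaced1 (normal_pred_conj f NN) _ gx.
  by rewrite !mulgA mulgV mul1g mulgK.
exists (f * h), y => u /hN.
by rewrite invgM !mulgA.
Qed.

(* Diagonal automorphisms turn the label of a half-space into any other one;
   the translation that remains is corrected by one that goes deeper into the
   half-space of z, along z, b or along z, b, c according to parity. *)
Let shrink f y z : exists2 h, H h & forall w, half y w -> half z (act (h * f) w).
Proof.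
have [r [v [Hr rv]]] : exists r v, H r /\
    forall w, half y w -> half z (v * act (r * f) w).
  pose P z := exists r v, H r /\
    forall w, half y w -> half z (v * act (r * f) w).
  apply: (@star_transitive L flexL P _ (local f 1 y) z).
    move=> x p px {}z [r [v [Hr rv]]].
    have [c [c1 cl]] := diagonal_ex (proj1 px).
    exists (c * r), (act c v); split.
      by apply: half_generatedM Hr; exact: diagonal_generated px c1 cl.
    move=> w /rv; rewrite -(half_act1 _ _ c1) cl (diagonalM _ _ c1 cl).
    by rewrite -mulgA [act (c * _) _]actM.
  exists 1, (act f 1)^-1; split; first by constructor.
  by move=> w; rewrite mul1g half_act.
have [b [c [zb bc zc]]] := indep_triple flexL z.
have bz : indep b z by rewrite indep_sym.
have cz : indep c z by rewrite indep_sym.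
have [Hv|Hv] := lmul_generated flexL v z.
  exists (lmul (gen z * gen b) * (lmul v * r)).
    exact: half_generatedM (even_generated flexL _ _) (half_generatedM Hv Hr).
  move=> w /rv; rewrite -!mulgA 2![act (lmul _ * _) _]actM !act_lmul.
  by move=> /(half_nest bz)/(half_nest zb); rewrite !mulgA.
exists (lmul (gen z * gen b) * (lmul (gen c * gen z)
    * (lmul (gen z) * lmul (v * gen z) * (lmul (gen z))^-1)) * r).
  apply: half_generatedM Hr; apply: half_generatedM (even_generated flexL _ _) _.
  by apply: half_generatedM (even_generated flexL _ _) _; exact: half_generatedJ.
move=> w /rv; rewrite -lmulV racg_genV -!lmulM -!mulgA.
rewrite [act (lmul _ * _) _]actM !act_lmul -!mulgA !mul_gen_genK.
by move=> /(half_nest cz)/(half_nest bc)/(half_nest zb); rewrite !mulgA.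
Qed.

Let spread1 (N : G -> Prop) z : normal_pred N ->
  (forall u, supported z u -> N u) ->
  forall f y u, supported y u -> N (f * u * f^-1).
Proof.
move=> [_ _ _ NJ] Nz f y u uy; have [h Hh hP] := shrink f y z.
have -> : f * u * f^-1 = h^-1 * (h * f * u * (h * f)^-1) * h^-1^-1.
  by rewrite invgK invgM !mulgA mulVg mul1g mulgVK.
apply: NJ; first exact: half_generatedV.
apply: Nz => w zw; rewrite 2!actM uy ?actKV //.
by apply/negbTE/negP => /hP; rewrite actKV zw.
Qed.

Let spread (N : G -> Prop) f z : normal_pred N ->
  (forall u, supported z u -> N (f * u * f^-1)) -> forall h, H h -> N h.
Proof.
move=> NN Nz; have [N1 NM _ _] := NN.
move=> h; elim=> [//|{}h y u g uy _ Ng]; apply: NM Ng.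
have := spread1 (normal_pred_conj f NN) Nz (f^-1 * h) uy.
by rewrite invgM invgK !mulgA mulgV mul1g mulgK.
Qed.

(** A non-trivial normal subgroup contains an element displacing a half-space,
    hence all automorphisms supported in some half-space, hence everything. *)
Theorem flexible_virtually_simple (x0 : L) : virtually_simple G.
Proof.
exists (@half_pred L); last exact: half_finite_index.
have Hclosed : group_closed (@half_pred L).
  split=> [|f g /half_predP Hf /half_predP Hg]; apply/half_predP.
    by constructor.
  exact/half_generatedM/half_generatedV.
split=> // [|N [[N1 NB] NH NJ]].
  have [p px p1] := star_nonrigid flexL x0.
  have [u [ux _ ul]] := twist_ex px.
  exists u; first exact/half_predP/(supported_generated ux).
  apply: contra_neq p1 => u1; have := ul (gen x0).
  by rewrite u1 local1 -[gen x0]mulg1 half_genl half1.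
have NV : invg_closed N by exact: group_closedV (conj N1 NB).
have NM : mulg_closed N by exact: group_closedM (conj N1 NB).
have [[g gN g1]|none] := pselect (exists2 g, g \in N & g != 1); last first.
  left=> g; rewrite inE; apply/idP/eqP => [gN|-> //].
  by apply/eqP; apply: contrapT => /negP g1; apply: none; exists g.
right=> h; apply/idP/half_predP => [/NH/half_predP//|Hh].
have NN : normal_pred (fun g => g \in N).
  split=> // k f /half_generatedV/half_predP Hk fN.
  by have := NJ _ _ Hk fN; rewrite conjgE invgK mulgA.
have [k [f [x [kN kx]]]] := displace_ex flexL NN gN g1.
have [f' [z zN]] := displaced NN kN kx.
exact: spread NN zN _ Hh.
Qed.

End Simplicity.


(** * Kneser complexes *)

Section KneserFlexible.
Variables (n : nat) (S : finType).
Hypotheses (n_gt1 : 1 < n) (n_lt : n < #|S|).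
Local Notation K := (kneser n S).
Implicit Types (A B C : K) (i j k a b c : S).

Lemma kneser_adjacent A B :
  adjacent A B = (A != B) && [disjoint val A & val B].
Proof.
rewrite /adjacent; apply/andP/andP => -[AB]; split=> //.
  move: b; rewrite inE => /forall_inP/(_ A); rewrite !inE eqxx => /(_ isT).
  by move=> /forall_inP/(_ B); rewrite !inE eqxx orbT AB => /(_ isT).
rewrite inE; apply/forall_inP => C; rewrite !inE => CP.
apply/forall_inP => D; rewrite !inE => DP; apply/implyP => CD.
case/orP: CP CD => /eqP->; case/orP: DP => /eqP->; rewrite ?eqxx //.
by rewrite disjoint_sym.
Qed.

Lemma kneser_indepP A B a b : a \in val A -> a \notin val B ->
  b \in val A -> b \in val B -> indep A B.
Proof.
move=> aA aB bA bB; rewrite /indep kneser_adjacent negb_and negbK.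
have AB : A != B by apply: contraNneq aB => <-.
rewrite AB (negbTE AB) /=; apply/pred0Pn; exists b.
by rewrite /= bA bB.
Qed.

Let kmap_subproof (s : {perm S}) A : #|s @: val A| == n.
Proof. by rewrite card_imset ?(valP A) //; exact: perm_inj. Qed.

Let kmap (s : {perm S}) A : K := Sub (s @: val A) (kmap_subproof s A).

Let kmap_inj s : injective (kmap s).
Proof.
by move=> A B /(congr1 val) /= /(imset_inj (@perm_inj _ s))/val_inj.
Qed.

Definition swap i j : {perm K} := perm (@kmap_inj (tperm i j)).

Lemma mem_swap i j k A : (k \in val (swap i j A)) = (tperm i j k \in val A).
Proof.
by rewrite permE /= -{1}(tpermK i j k) mem_imset //; exact: perm_inj.
Qed.

(** A transposition of two points of C fixes the sets disjoint from C and C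
    itself, but moves the sets that contain only one of the two points: the
    reason why the blocks must have at least two elements. *)
Lemma swap_star_fixing i j C : i \in val C -> j \in val C ->
  star_fixing C (swap i j).
Proof.
move=> iC jC; have fixed A : (i \in val A) = (j \in val A) -> swap i j A = A.
  move=> ij; apply/val_inj/setP => k; rewrite mem_swap.
  by case: tpermP => // ->; rewrite ij.
split=> [A B|A].
  rewrite !kneser_adjacent (inj_eq perm_inj) !permE /= -!setI_eq0.
  by rewrite -imsetI ?imset_eq0 // => k l _ _; exact: perm_inj.
rewrite inE => /orP[/eqP->|]; first by rewrite fixed // iC jC.
rewrite kneser_adjacent => /andP[_ /pred0P dis]; apply: fixed.
by move: (dis i) (dis j); rewrite /= iC jC /= => -> ->.
Qed.

Let two A i : exists2 j, j \in val A & j != i.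
Proof.
apply/exists_inP; apply: contraTT n_gt1 => /exists_inPn one.
rewrite -leqNgt -(eqP (valP A)) -(cards1 i) subset_leq_card //.
by apply/subsetP => j /one; rewrite negbK inE.
Qed.

Let inhab A : exists i, i \in val A.
Proof.
by apply/set0Pn; rewrite -card_gt0 (eqP (valP A)); exact: ltnW.
Qed.

Let outside A : exists c, c \notin val A.
Proof.
apply/existsP; apply: contraLR n_lt => /existsPn all_in.
rewrite -leqNgt -(eqP (valP A)) subset_leq_card //.
by apply/subsetP => i _; have := all_in i; rewrite negbK.
Qed.

Lemma kneser_flexible : star_flexible K.
Proof.
split.
(* Exchanging a point of A outside B for a point of B outside A; the second
   point a of A makes room for a set swap a j A that contains both. *)
- move=> P Pst A B; have [m] := ubnP #|val A :\: val B|.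
  elim: m A => // m IH A /ltnSE Am PA.
  have [AB|] := boolP (val A \subset val B).
    suff <- : A = B by [].
    apply/val_inj/eqP; rewrite eqEcard AB.
    by rewrite (eqP (valP A)) (eqP (valP B)) /=.
  case/subsetPn => i iA iB.
  have [j jB jA] : exists2 j, j \in val B & j \notin val A.
    apply/subsetPn; apply: contra iB => BA; suff <- : A = B by [].
    apply/esym/val_inj/eqP; rewrite eqEcard BA.
    by rewrite (eqP (valP A)) (eqP (valP B)) /=.
  have [a aA ai] := two A i.
  have ij : i != j by apply: contraTneq iA => ->.
  have aj : a != j by apply: contraTneq aA => ->.
  have Pswap : P (swap i j A).
    apply: (Pst (swap a j A)) => //; apply: swap_star_fixing.
      by rewrite mem_swap tpermD // eq_sym.
    by rewrite mem_swap tpermR.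
  apply: IH Pswap; apply: leq_trans Am; apply: proper_card.
  apply/properP; split.
    apply/subsetP => k; rewrite !inE mem_swap => /andP[kB].
    rewrite kB; case: tpermP => [->|ekj|//]; first by rewrite (negbTE jA).
    by rewrite ekj jB in kB.
  exists i; first by rewrite inE iB.
  by rewrite inE mem_swap tpermL (negbTE jA) andbF.
- move=> A; have [a aA] := inhab A; have [b bA ba] := two A a.
  have [c cA] := outside A; exists (swap a b); first exact: swap_star_fixing.
  have ca : c != a by apply: contraNneq cA => ->.
  have cb : c != b by apply: contraNneq cA => ->.
  apply/eqP => /permP/(_ (swap a c A)) /(congr1 (fun B : K => a \in val B)).
  have bac : tperm a c b = b by rewrite tpermD // eq_sym.
  by rewrite perm1 !mem_swap !tpermL bac bA (negbTE cA).
- move=> A; have [a aA] := inhab A; have [b bA ba] := two A a.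
  have [c cA] := outside A; exists (swap a c A), (swap b c A).
  have ca : c != a by apply: contraNneq cA => ->.
  have cb : c != b by apply: contraNneq cA => ->.
  have bac : tperm a c b = b by rewrite tpermD // eq_sym.
  have abc : tperm b c a = a by rewrite tpermD.
  split.
  + apply: (@kneser_indepP _ _ a b); rewrite ?mem_swap ?tpermL ?bac //.
  + apply: (@kneser_indepP _ _ b c); rewrite ?mem_swap ?tpermL ?tpermR ?bac //.
  apply: (@kneser_indepP _ _ b a); rewrite ?mem_swap ?tpermL ?abc //.
move=> A B; rewrite kneser_adjacent => /andP[_ /pred0P dis].
have [a aA] := inhab A; have [b bA ba] := two A a; have [c cB] := inhab B.
have nB i : i \in val A -> i \notin val B.
  by move=> iA; have := dis i; rewrite /= iA /= => ->.
have cA : c \notin val A by apply: contraL cB => /nB.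
have cb : c != b by apply: contraNneq cA => ->.
have bac : tperm a c b = b by rewrite tpermD // eq_sym.
exists (swap a c A).
  by apply: (@kneser_indepP _ _ a b); rewrite ?mem_swap ?tpermL ?bac.
rewrite indep_sym; apply: (@kneser_indepP _ _ b c);
by rewrite ?mem_swap ?tpermR ?bac // nB.
Qed.

Lemma kneser_inhabited : inhabited K.
Proof.
have cA : #|[set i in take n (enum S)]| == n.
  rewrite cardsE (card_uniqP _) ?take_uniq ?enum_uniq // size_take -cardE.
  by rewrite n_lt.
by exists; exact: (Sub [set i in take n (enum S)] cA).
Qed.

End KneserFlexible.

Local Close Scope group_scope.

Theorem corollary5p5 (n d : nat) (hn : 2 <= n) (hd : 1 <= d) :
  virtually_simple (cubeAut (davis (kneser n 'I_(n * d + 1)))).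
Proof.
have lt_n : n < #|'I_(n * d + 1)| by rewrite card_ord addn1 ltnS leq_pmulr.
have [x0] := kneser_inhabited lt_n.
exact: flexible_virtually_simple (kneser_flexible hn lt_n) x0.
Qed.
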